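(* Let $n\geq 2$ and $F=\mathbb{C}(x_1,\ldots,x_n)$ be the field of rational functions in $n$ indeterminates over $\mathbb{C}$. Then $I^nF$ is $3$-linked but not $2^n$-linked. That is: any three bilinear $n$-fold Pfister forms over $F$ share a common $(n-1)$-fold factor, but there exist $2^n$ bilinear $n$-fold Pfister forms over $F$ which do not share a common $(n-1)$-fold factor.
   Context: For a field $F$, $W F$ is the Witt ring of symmetric bilinear forms over $F$ and $IF$ its ideal of even-dimensional forms; $I^nF$ is its $n$-th power, generated by bilinear $n$-fold Pfister forms. For $a\in F^\times$, $\langle\langle a\rangle\rangle$ denotes the bilinear form $\langle 1,-a\rangle$, and a bilinear $n$-fold Pfister form is one of the form $\langle\langle a_1,\ldots,a_n\rangle\rangle=\langle 1,-a_1\rangle\otimes\cdots\otimes\langle 1,-a_n\rangle$ with $a_i\in F^\times$. A collection of bilinear $n$-fold Pfister forms $\varphi_1,\dots,\varphi_m$ shares a common $(n-1)$-fold factor if there is a bilinear $(n-1)$-fold Pfister form $\pi$ and elements $b_1,\dots,b_m\in F^\times$ with $\varphi_j\cong \pi\otimes\langle\langle b_j\rangle\rangle$ (isometry of bilinear forms) for all $j$. For $m,n\geq 2$, $I^nF$ is called $m$-linked if every $m$ bilinear $n$-fold Pfister forms over $F$ share a common $(n-1)$-fold factor. *)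

(* Defs.v *)
From mathcomp Require Import all_boot all_algebra.
From mathcomp Require Import Rstruct.
From mathcomp Require Import complex fraction.
From mathcomp Require Import mpoly.
Set Implicit Arguments. Unset Strict Implicit. Unset Printing Implicit Defensive.
Import GRing.Theory.
Local Open Scope ring_scope.

(* Diagonal symmetric bilinear forms over a field K, given by the list of
   their diagonal entries <s_0, ..., s_{k-1}>. *)
Section BilinearForms.
Variable K : fieldType.

Definition gram (k : nat) (s : seq K) : 'M[K]_k :=
  \matrix_(i < k, j < k) (if i == j then s`_i else 0).

Definition isometric (s t : seq K) : Prop :=
  size s = size t /\
  exists P : 'M[K]_(size s),
    P \in unitmx /\ P *m gram (size s) s *m P^T = gram (size s) t.

Definition tens (s t : seq K) : seq K := [seq x * y | x <- s, y <- t].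

Definition pf1 (a : K) : seq K := [:: 1; - a].

Fixpoint pf (l : seq K) : seq K :=
  if l is a :: l' then tens (pf l') (pf1 a) else [:: 1].

Definition is_pfister (n : nat) (phi : seq K) : Prop :=
  exists l : seq K, size l = n /\ all (fun a => a != 0) l /\ phi = pf l.

Definition m_linked (m n : nat) : Prop :=
  forall phi : 'I_m -> seq K, (forall j, is_pfister n (phi j)) ->
  exists pi : seq K, is_pfister n.-1 pi /\
  exists b : 'I_m -> K, (forall j, b j != 0) /\
    forall j, isometric (phi j) (tens pi (pf1 (b j))).

End BilinearForms.

Definition CC := complex Rdefinitions.R.
Definition ratfun (n : nat) : fieldType := {fraction {mpoly CC[n]}}.

(* Main.v *)
(** Let F be the field of rational functions in n variables over the complex numbers.

    3-linked.  By Tsen-Lang, r diagonal quadrics over F in more than r 2^n variables have a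
    common nontrivial zero.  If three n-fold Pfister forms share a k-fold factor pi with
    k <= n - 2, the complements of pi in them have dimension 2^n - 2^k, and
    3 (2^n - 2^k) > 2 * 2^n yields a common nonzero value - d of these complements; then
    pi can be enlarged to pi (x) <<d>>.  Tsen-Lang reduces, by counting coefficients, to the
    fact that M quadratic forms over C in more than M variables have a common nontrivial
    zero.  Otherwise, by the Nullstellensatz, their ideal contains a power of every variable,
    so the polynomial ring is finite over the subring generated by the M forms, which grows
    too slowly.

    Not 2^n-linked.  For each set S of indices take the form with slots - (x_i + [i in S]).
    A common slot a makes - a a common value of the pure parts of these 2^n forms.  In
    residue characteristic 2 such a value vanishes.  Instead of extending the dyadic
    valuation to C, clear denominators and let c range over the coefficients of all the
    polynomials involved: modulo 2 the identities are linear in the squares c^2, and mixed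
    derivatives show that every c^2 is twice an integral combination of products of two
    coefficients.  This forces c = 0 since det (1 - 2 M) is odd for integral M. *)
From Stdlib Require Import Classical ClassicalEpsilon Reals Lra.
Require Import Defs.
From mathcomp Require Import all_boot all_algebra.
From mathcomp Require Import Rstruct complex fraction mpoly.
From mathcomp Require Import ring zify.
Set Implicit Arguments. Unset Strict Implicit. Unset Printing Implicit Defensive.
Import GRing.Theory Num.Theory.
Local Open Scope ring_scope.

(** * Linear dependence and uncountability *)

(** The coefficient matrix has more rows than columns, so its left kernel contains a nonzero row,
    whose entries are the coefficients of the relation. *)
Lemma lin_dep (K : fieldType) (V : lmodType K) (I J : finType)
    (u : I -> V) (w : J -> V) :
  (forall i, exists c : J -> K, u i = \sum_j c j *: w j) -> (#|J| < #|I|)%N ->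
  exists a : I -> K, (exists i, a i != 0) /\ \sum_i a i *: u i = 0.
Proof.
move=> /(choice _) [c cP] ltJI.
pose A := \matrix_(i < #|I|, j < #|J|) c (enum_val i) (enum_val j).
have /rowV0Pn [v vA vN0] : kermx A != 0.
  rewrite -mxrank_eq0 mxrank_ker subn_eq0 -ltnNge.
  exact: leq_ltn_trans (rank_leq_col A) ltJI.
exists (fun i => v 0 (enum_rank i)); split.
  case/rV0Pn: vN0 => i vi; exists (enum_val i); by rewrite enum_valK.
transitivity (\sum_i \sum_j (v 0 (enum_rank i) * c i j) *: w j).
  by apply: eq_bigr => i _; rewrite cP scaler_sumr; apply: eq_bigr => j _; rewrite scalerA.
rewrite exchange_big /= big1 // => j _; rewrite -scaler_suml.
suff -> : \sum_i v 0 (enum_rank i) * c i j = 0 by rewrite scale0r.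
move/sub_kermxP/rowP: vA => /(_ (enum_rank j)); rewrite !mxE => vj; apply: etrans vj.
rewrite [RHS](reindex (@enum_rank I)) /=; last exact: onW_bij (enum_rank_bij I).
by apply: eq_bigr => i _; rewrite mxE !enum_rankK.
Qed.

Section RealsUncountable.
Local Open Scope R_scope.

(** Nested intervals: if [u n] lies left of the midpoint the right third is kept, otherwise the left
    third, so the new interval misses [u n]. The supremum of the left ends lies in every
    interval. *)
Lemma R_not_enumerable (u : nat -> R) : exists x, forall n, u n <> x.
Proof.
pose step (ab : R * R) y := let: (a, b) := ab in
  if Rlt_dec y ((a + b) / 2) then ((a + 2 * b) / 3, b) else (a, (2 * a + b) / 3).
pose I := fix I n := if n is n'.+1 then step (I n') (u n') else (0, 1).
have lt_I n : (I n).1 < (I n).2.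
  elim: n => [|n] /=; first by lra.
  by rewrite /step; case: (I n) => a b /= ab; case: Rlt_dec => _ /=; lra.
have sub n : (I n).1 <= (I n.+1).1 /\ (I n.+1).2 <= (I n).2.
  have := lt_I n; rewrite /= /step; case: (I n) => a b /= ab.
  by case: Rlt_dec => _ /=; lra.
have mono n k : (I n).1 <= (I (k + n)%N).1 /\ (I (k + n)%N).2 <= (I n).2.
  elim: k => [|k IH]; first by rewrite add0n; lra.
  by have := sub (k + n)%N; rewrite addSn; lra.
have cross n m : (I n).1 <= (I m).2.
  case: (leqP n m) => nm.
    by have := mono n (m - n)%N; have := lt_I m; rewrite subnK //; lra.
  by have := mono m (n - m)%N; have := lt_I n; rewrite subnK 1?ltnW //; lra.
have [||x [ub lub]] := completeness (fun x => exists n, x = (I n).1).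
- by exists 1 => _ [n ->]; have := cross n 0%N.
- by exists 0, 0%N.
exists x => n unx.
have h1 : (I n.+1).1 <= x by apply: ub; exists n.+1.
have h2 : x <= (I n.+1).2 by apply: lub => _ [m ->].
have := lt_I n; move: h1 h2; rewrite /= /step unx; case: (I n) => a b /=.
by case: Rlt_dec => /=; lra.
Qed.

End RealsUncountable.

(** Uncountability in pigeonhole form: [T] is not a countable union of finite sets, so every map to
    [nat] has an infinite fibre. *)
Definition uncountable (T : eqType) := forall f : T -> nat, exists k,
  forall N, exists s : seq T, [/\ uniq s, size s = N & forall x, x \in s -> f x = k].

(** If all fibres of [f] were finite, the pairs of a value and a position in the list of its fibre
    would enumerate [T]. *)
Lemma uncountable_not_enumerable (T : eqType) :
  (forall u : nat -> option T, exists x, forall n, u n <> Some x) -> uncountable T.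
Proof.
move=> noenum f; apply: NNPP => nok.
have fin k : exists s : seq T, forall x, f x = k -> x \in s.
  apply: NNPP => nos; apply: nok; exists k; elim=> [|N [s [us sN sk]]].
    by exists [::].
  case: (classic (exists x, f x = k /\ x \notin s)) => [[x [fx xs]]|nox].
    exists (x :: s); split=> /=; rewrite ?xs ?sN //.
    by move=> y; rewrite inE => /orP[/eqP->|/sk].
  case: nos; exists s => x fx; apply/negP => /negP xs.
  by case: nox; exists x.
have [l lP] := choice _ fin.
have [x xP] := noenum (fun n => if unpickle n is Some (k, i) then onth (l k) i else None).
apply: (xP (pickle (f x, index x (l (f x))))); rewrite pickleK.
have xl := lP _ _ (erefl (f x)).
by rewrite onthE (nth_map x) ?index_mem // nth_index.
Qed.

Lemma uncountable_CC : uncountable CC.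
Proof.
apply: uncountable_not_enumerable => u.
have [x xP] := R_not_enumerable (fun n => if u n is Some z then complex.Re z else 0).
by exists (Complex x 0) => n un; apply: (xP n); rewrite un.
Qed.

(** * Nullstellensatz *)

Section Nullstellensatz.
Variables (K : closedFieldType) (U : nat).
Hypothesis uncountableK : uncountable K.
Notation A := {mpoly K[U]}.
Implicit Types (J : A -> Prop) (p q g h : A).

Definition ideal J := [/\ J 0, forall p q, J p -> J q -> J (p + q)
  & forall p q, J q -> J (p * q)].

Definition adjoin J q p := exists h, J (p - h * q).

Lemma ideal_adjoin J q : ideal J -> ideal (adjoin J q).
Proof.
case=> J0 JD JM; split.
- by exists 0; rewrite mul0r subr0.
- move=> p p' [h hP] [h' hP']; exists (h + h').
  by have := JD _ _ hP hP'; congr J; ring.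
- move=> p p' [h hP]; exists (p * h).
  by have := JM p _ hP; congr J; ring.
Qed.

Lemma ideal_sum J (I : Type) (r : seq I) (P : pred I) (F : I -> A) :
  ideal J -> (forall i, P i -> J (F i)) -> J (\sum_(i <- r | P i) F i).
Proof. by case=> J0 JD _; exact: big_ind. Qed.

(* Otherwise each ['X_i - c] divides a power of [g] modulo [J]. Uncountably many cofactors
   lie in a space of bounded degree; a linear relation between them gives a nonzero
   univariate polynomial [p] with [g ^+ d * p('X_i)] in [J], and the linear factors of [p]
   again divide powers of [g]. *)
Lemma ideal_specialize J g (i : 'I_U) :
  ideal J -> (forall d, ~ J (g ^+ d)) ->
  exists c : K, forall d, ~ adjoin J ('X_i - c%:MP) (g ^+ d).
Proof.
move=> idJ avJ; have [J0 JD JM] := idJ; apply: NNPP => noc.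
have {noc} inv c : exists dh : nat * A, J (g ^+ dh.1 - dh.2 * ('X_i - c%:MP)).
  apply: NNPP => no; apply: noc; exists c => d [h hP].
  by apply: no; exists (d, h).
have [dh dhP] := choice _ inv.
(* The map records the exponent of [g] and the size of the cofactor; all elements of one fibre share
   both, and [x0] serves to name them [d] and [D]. *)
have [k kP] := uncountableK (fun c => pickle ((dh c).1, msize (dh c).2)).
have [s1 [_ s1N s1P]] := kP 1%N.
have [x0 kx0] : exists x, pickle ((dh x).1, msize (dh x).2) = k.
  by case: s1 s1N s1P => // x s1 _ s1P; exists x; apply/s1P/mem_head.
set d := (dh x0).1 in kx0; set D := msize (dh x0).2 in kx0.
have [s [us sN sk]] := kP #|{: 'X_{1..U < D}}|.+1.
have dhE c : c \in s -> (dh c).1 = d /\ (msize (dh c).2 <= D)%N.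
  move=> /sk; rewrite -kx0 => /(pcan_inj pickleK) [-> ->]; by [].
pose c (t : 'I_(size s)) := s`_t.
have cs t : c t \in s by apply: mem_nth.
have c_inj : injective c by move=> t t' /eqP; rewrite nth_uniq // => /eqP /val_inj.
have [||a [[t0 at0] a0]] := @lin_dep K A _ _ (fun t => (dh (c t)).2)
    (fun m : 'X_{1..U < D} => 'X_[m]).
- move=> t; have [_ le] := dhE _ (cs t).
  by exists (fun m : 'X_{1..U < D} => (dh (c t)).2@_m); apply: mpolywE.
- by rewrite card_ord sN.
pose P (t : 'I_(size s)) : {poly K} := \prod_(u | u != t) ('X - (c u)%:P).
(* This is the numerator of the sum of the fractions [a t / ('X - c t)]. At [c t0] only the term
   [t0] survives, hence [p] is nonzero. *)
pose p : {poly K} := \sum_t a t *: P t.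
have p0 : p != 0.
  apply/eqP => /(congr1 (fun f : {poly K} => f.[c t0])); rewrite horner0 horner_sum (bigD1 t0) //=.
  rewrite [X in _ + X]big1 => [|t tt0]; last first.
    rewrite hornerZ horner_prod (bigD1 t0) 1?eq_sym //=.
    by rewrite hornerXsubC subrr mul0r mulr0.
  rewrite addr0 hornerZ => /eqP; rewrite mulf_eq0 (negPf at0) /= horner_prod prodf_seq_eq0.
  case/hasP => u _; rewrite hornerXsubC subr_eq0 => /andP[ut /eqP/c_inj tu].
  by rewrite tu eqxx in ut.
pose ev : {poly K} -> A := horner_alg ('X_i : A).
have evX z : ev ('X - z%:P) = 'X_i - z%:MP.
  by rewrite /ev rmorphB /= horner_algX horner_algC alg_mpolyC.
have evM f f' : ev (f * f') = ev f * ev f' by apply: rmorphM.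
have evZ z f : ev (z *: f) = z *: ev f by rewrite /ev linearZ /= mulr_algl.
have a0' : \sum_t (a t *: ev (P t)) * ((dh (c t)).2 * ('X_i - (c t)%:MP)) = 0.
  transitivity ((\sum_t a t *: (dh (c t)).2) * ev (\prod_t ('X - (c t)%:P))).
    rewrite mulr_suml; apply: eq_bigr => t _.
    by rewrite (bigD1 t) //= evM evX -/(P t) -!mul_mpolyC; ring.
  by rewrite a0 mul0r.
have Jp : J (g ^+ d * ev p).
  have -> : g ^+ d * ev p =
    \sum_t (a t *: ev (P t)) * (g ^+ (dh (c t)).1 - (dh (c t)).2 * ('X_i - (c t)%:MP)).
    under [RHS]eq_bigr => t _ do rewrite mulrBr.
    rewrite sumrB a0' subr0 /ev linear_sum /= mulr_sumr; apply: eq_bigr => t _.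
    by have [-> _] := dhE _ (cs t); rewrite -[horner_alg _ _]/(ev _) evZ mulrC.
  by apply: ideal_sum => // t _; apply: JM.
have [r pE] := closed_field_poly_normal p.
have : J (g ^+ d * \prod_(z <- r) ('X_i - z%:MP)).
  have := JM (lead_coef p)^-1%:MP _ Jp; congr J.
  rewrite {2}pE evZ /ev rmorph_prod /= -mul_mpolyC [g ^+ d * (_ * _)]mulrCA !mulrA.
  rewrite -mpolyCM mulVf ?lead_coef_eq0 // mpolyC1 mul1r; congr (_ * _).
  by apply: eq_bigr => z _; rewrite -/(ev _) evX.
elim: r (d) {pE} => [|z r IH] e; first by rewrite big_nil mulr1; apply: avJ.
rewrite big_cons => Je; apply: (IH (e + (dh z).1)%N).
have := JD _ _ (JM (dh z).2 _ Je) (JM (g ^+ e * \prod_(z <- r) ('X_i - z%:MP)) _ (dhP z)).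
by congr J; rewrite exprD; ring.
Qed.

(** The variables are specialized one at a time, keeping the powers of [g] out of the ideal. In the
    end every polynomial is congruent to its value at [c], and the ideal contains no nonzero
    constant. *)
Lemma nullstellensatz J g : ideal J -> (forall d, ~ J (g ^+ d)) ->
  exists c : 'I_U -> K, (forall p, J p -> p.@[c] = 0) /\ g.@[c] != 0.
Proof.
move=> idJ avJ.
have spec (s : seq 'I_U) : exists (c : 'I_U -> K) J', [/\ ideal J',
    forall d, ~ J' (g ^+ d), forall p, J p -> J' p
    & forall i, i \in s -> J' ('X_i - (c i)%:MP)].
  elim: s => [|i s [c [J' [idJ' avJ' JJ' cJ']]]]; first by exists (fun=> 0), J.
  have [J0 JD JM] := idJ'.
  have [is_|is_] := boolP (i \in s).
    by exists c, J'; split=> // j; rewrite inE => /orP[/eqP->|]; exact: cJ'.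
  have [z zP] := ideal_specialize i idJ' avJ'.
  exists (fun j => if j == i then z else c j), (adjoin J' ('X_i - z%:MP)).
  split=> //; first exact: ideal_adjoin.
    by move=> p /JJ' Jp; exists 0; rewrite mul0r subr0.
  move=> j; rewrite inE; case: eqP => [->|_] /= js.
    by exists 1; rewrite mul1r subrr.
  by exists 0; rewrite mul0r subr0; apply: cJ'.
have [c [J' [idJ' avJ' JJ' cJ']]] := spec (enum 'I_U).
have [J0 JD JM] := idJ'.
have ev p : J' (p - p.@[c]%:MP).
  rewrite [p]mpolyE; apply: (big_ind (fun p => J' (p - p.@[c]%:MP))).
  - by rewrite meval0 mpolyC0 subr0.
  - move=> q q' Jq Jq'; rewrite mevalD mpolyCD.
    by have := JD _ _ Jq Jq'; congr J'; ring.
  move=> m _; rewrite mevalZ mpolyCM -mul_mpolyC -mulrBr; apply: (JM).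
  have cM q q' : J' (q - q.@[c]%:MP) -> J' (q' - q'.@[c]%:MP) ->
      J' (q * q' - (q * q').@[c]%:MP).
    move=> Jq Jq'; rewrite mevalM mpolyCM.
    by have := JD _ _ (JM q' _ Jq) (JM q.@[c]%:MP _ Jq'); congr J'; ring.
  rewrite mpolyXE_id; apply: (big_ind (fun p => J' (p - p.@[c]%:MP))) => //.
    by rewrite meval1 mpolyC1 subrr.
  move=> i _; elim: (m i) => [|k IH]; first by rewrite expr0 meval1 mpolyC1 subrr.
  by rewrite exprS; apply: cM => //; rewrite mevalXU; apply: cJ'; rewrite mem_enum.
have J'1 : ~ J' 1 by apply: (avJ' 0%N).
have J'C z : J' z%:MP -> z = 0.
  move=> Jz; apply/eqP/negPn/negP => z0; apply: J'1.
  by have := JM z^-1%:MP _ Jz; rewrite -mpolyCM mulVf // mpolyC1.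
have J'B p q : J' p -> J' q -> J' (p - q).
  by move=> Jp Jq; rewrite -mulN1r; apply: JD => //; apply: JM.
exists c; split=> [p /JJ' Jp|].
  by apply: J'C; have := J'B _ _ Jp (ev p); congr J'; ring.
apply/eqP => gc; apply: (avJ' 1%N); rewrite expr1.
by have := ev g; rewrite gc mpolyC0 subr0.
Qed.

End Nullstellensatz.

(** * Common zeros of quadratic forms *)

Section CommonZero.
Variables (K : closedFieldType) (U M : nat) (f : 'I_M -> {mpoly K[U]}).
Hypothesis uncountableK : uncountable K.
Hypothesis homf : forall j, f j \is 2.-homog.

Lemma pihomogM k (p q : {mpoly K[U]}) : q \is 2.-homog ->
  pihomog mdeg k.+2 (p * q) = pihomog mdeg k p * q.
Proof.
move=> homq; rewrite {1}[p]mpolyE mulr_suml [in RHS](mpolyE p) !linear_sum /= mulr_suml.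
apply: eq_bigr => m _; rewrite -scalerAl !linearZ /= -scalerAl; congr (_ *: _).
have homXq : 'X_[m] * q \is (mdeg m + 2).-homog by rewrite dhomogM ?dhomogX.
rewrite pihomogX; case: eqP => [<-|nk]; first by rewrite pihomog_dE // -[_.+2]addn2.
by rewrite mul0r (pihomog_ne0 _ homXq) // addn2; apply/eqP => -[].
Qed.

Definition prodmon (b : 'I_U -> nat) (a : 'I_M -> nat) : {mpoly K[U]} :=
  'X_[[multinom b i | i < U]] * \prod_j f j ^+ a j.

(** There are [d ^ U * e.+1 ^ M] generators; for fixed [d] this grows only like [e ^ M]. *)
Definition monspan d e (p : {mpoly K[U]}) :=
  exists c : {ffun 'I_U -> 'I_d} * {ffun 'I_M -> 'I_e.+1} -> K,
    p = \sum_x c x *: prodmon (fun i => x.1 i) (fun j => x.2 j).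

Lemma monspan_gen d e b a : (forall i, b i < d)%N -> (forall j, a j <= e)%N ->
  monspan d e (prodmon b a).
Proof.
move=> bd ae; pose x : {ffun 'I_U -> 'I_d} * {ffun 'I_M -> 'I_e.+1} :=
  ([ffun i => Ordinal (bd i)], [ffun j => Ordinal (ae j : a j < e.+1)%N]).
exists (fun y => (y == x)%:R); rewrite (bigD1 x) //= eqxx scale1r big1 ?addr0.
  rewrite /prodmon; congr ('X_[_] * _); first by apply/mnmP => i; rewrite !mnmE ffunE.
  by apply: eq_bigr => j _; rewrite ffunE.
by move=> y /negPf ->; rewrite scale0r.
Qed.

Lemma monspan_sum d e (I : Type) (r : seq I) (P : pred I) (c : I -> K) F :
  (forall i, P i -> monspan d e (F i)) -> monspan d e (\sum_(i <- r | P i) c i *: F i).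
Proof.
move=> FS; apply: big_ind => [|p q [c1 ->] [c2 ->]|i /FS [c1 ->]].
- by exists (fun=> 0); rewrite big1 // => x _; rewrite scale0r.
- exists (fun x => c1 x + c2 x); rewrite -big_split /=.
  by apply: eq_bigr => x _; rewrite scalerDl.
- exists (fun x => c i * c1 x); rewrite scaler_sumr.
  by apply: eq_bigr => x _; rewrite scalerA.
Qed.

Lemma monspan_mul d e j p : monspan d e p -> monspan d e.+1 (p * f j).
Proof.
case=> c ->; rewrite mulr_suml.
under eq_bigr => x _ do rewrite -scalerAl.
apply: monspan_sum => -[b a] _ /=.
have -> : prodmon (fun i => b i) (fun i => a i) * f j =
    prodmon (fun i => b i) (fun i => a i + (i == j))%N.
  rewrite /prodmon -mulrA; congr (_ * _).
  rewrite (bigD1 j) //= [in RHS](bigD1 j) //= eqxx addn1 exprSr -!mulrA; congr (_ * _).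
  rewrite mulrC; congr (_ * _); apply: eq_bigr => i /negPf ->; by rewrite addn0.
apply: monspan_gen => // i; have := ltn_ord (a i); by case: eqP; lia.
Qed.

(* If the powers ['X_i ^+ d] lie in the ideal of the [f j], every form is a combination of
   boundedly many monomials with coefficients in [K[f_1, ..., f_M]], a ring of smaller growth
   than the polynomial ring when [M < U]. *)
Lemma quadrics_common_zero : (M < U)%N ->
  exists c : 'I_U -> K, (exists i, c i != 0) /\ forall j, (f j).@[c] = 0.
Proof.
move=> MU; apply: NNPP => nozero.
pose J p := exists g : 'I_M -> {mpoly K[U]}, p = \sum_j g j * f j.
have idJ : ideal J.
  split.
  - by exists (fun=> 0); rewrite big1 // => j _; rewrite mul0r.
  - move=> p q [g ->] [g' ->]; exists (fun j => g j + g' j).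
    by rewrite -big_split; apply: eq_bigr => j _; rewrite /= mulrDl.
  - move=> p q [g ->]; exists (fun j => p * g j).
    by rewrite mulr_sumr; apply: eq_bigr => j _; rewrite mulrA.
have [_ _ JM] := idJ.
have pow i : exists d, J ('X_i ^+ d).
  apply: NNPP => no.
  have [|c [cJ ci]] := @nullstellensatz K U uncountableK J 'X_i idJ.
    by move=> d Jd; apply: no; exists d.
  apply: nozero; exists c; split; first by exists i; rewrite mevalXU in ci.
  move=> j; apply: cJ; exists (fun k => (k == j)%:R).
  rewrite (bigD1 j) //= eqxx mul1r big1 ?addr0 // => k /negPf ->; by rewrite mul0r.
have [D DP] := choice _ pow.
pose d := (\sum_i D i).
(* A single exponent serves all variables. Writing it [d.+2] makes the homogeneous coefficients of
   the quadratic forms have degree [d]. *)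
have {DP} powd i : J ('X_i ^+ d.+2).
  rewrite -(@subnK (D i) d.+2) ?exprD; first exact: JM.
  by rewrite /d (bigD1 i) //= -!addnS leq_addr.
have {powd} powd i : exists g : 'I_M -> {mpoly K[U]},
    (forall j, g j \is d.-homog) /\ 'X_i ^+ d.+2 = \sum_j g j * f j.
  have [g gE] := powd i; exists (fun j => pihomog mdeg d (g j)).
  split=> [j|]; first exact: pihomogP.
  have homX : ('X_i : {mpoly K[U]}) ^+ d.+2 \is (d.+2).-homog.
    by rewrite -[X in X.-homog]mul1n dhomogMn // dhomogX /= mdeg1.
  rewrite -(pihomog_dE homX) gE linear_sum /=.
  by apply: eq_bigr => j _; rewrite pihomogM.
have XE m : 'X_[m] = prodmon m (fun=> 0%N).
  rewrite /prodmon big1 // mulr1.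
  by congr 'X_[_]; apply/mnmP => i; rewrite mnmE.
(* Induction on the degree bound: a factor ['X_i ^+ d.+2] is replaced by the sum of the [g j * f j],
   which leaves monomials of degree lower by 2 in front of one more factor [f j]. *)
have span e m : (mdeg m <= e)%N -> monspan d.+2 e 'X_[m].
  elim: e m => [|e IH] m me; have [i dm|small] := pickP (fun i => d.+2 <= m i)%N.
  - by move: me dm; rewrite mdegE (bigD1 i) //=; lia.
  - by rewrite XE; apply: monspan_gen => // i; rewrite ltnNge small.
  2: by rewrite XE; apply: monspan_gen => // i; rewrite ltnNge small.
  have [g [homg gE]] := powd i.
  have mE : m = (m - U_(i) *+ d.+2 + U_(i) *+ d.+2)%MM.
    rewrite submK //; apply/mnm_lepP => k; rewrite mulmnE mnm1E.
    by case: eqP => [<-|_]; rewrite ?mul1n ?mul0n.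
  have degm : mdeg m = (mdeg (m - U_(i) *+ d.+2)%MM + d.+2)%N.
    by rewrite {1}mE mdegD mdegMn mdeg1 mul1n.
  rewrite mE mpolyXD -mpolyXn gE mulr_sumr.
  under eq_bigr => j _ do rewrite mulrA -[_ * f j]scale1r.
  apply: monspan_sum => j _; apply: monspan_mul.
  have /dhomogP hom : 'X_[(m - U_(i) *+ d.+2)] * g j \is
      (mdeg (m - U_(i) *+ d.+2)%MM + d).-homog by rewrite dhomogM ?dhomogX.
  rewrite [_ * g j]mpolyE big_seq_cond; apply: monspan_sum => k; rewrite andbT => /hom kE.
  by apply: IH; rewrite kE; move: me; rewrite degm !addnS ltnS => /ltnW.
(* The [s ^ U] monomials with exponents below [s] have degree at most [U * s]. This [s] gives [d.+2
   ^ U * (U * s).+1 ^ M < s ^ M.+1 <= s ^ U], so they are linearly dependent. *)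
pose s := (d.+2 ^ U * U.+1 ^ M).+1.
pose mon (x : {ffun 'I_U -> 'I_s}) : 'X_{1..U} := [multinom (x i : nat) | i < U].
have mon_inj : injective mon.
  by move=> x y /mnmP xy; apply/ffunP => i; apply: val_inj; have := xy i; rewrite !mnmE.
have [||a [[x0 ax0] a0]] := @lin_dep K {mpoly K[U]} {ffun 'I_U -> 'I_s}
    ({ffun 'I_U -> 'I_d.+2} * {ffun 'I_M -> 'I_(U * s).+1})%type (fun x => 'X_[mon x])
    (fun x => prodmon (fun i => x.1 i) (fun j => x.2 j)).
- move=> x; apply: span; rewrite mdegE; apply: (@leq_trans (\sum_(i < U) s)%N).
    by apply: leq_sum => i _; rewrite mnmE ltnW.
  by rewrite sum_nat_const card_ord.
- rewrite card_prod !card_ffun !card_ord.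
  apply: (@leq_ltn_trans (d.+2 ^ U * (U.+1 * s) ^ M)%N).
    by rewrite leq_mul2l; apply/orP; right; case: (M) => // M'; rewrite leq_exp2r // mulSn; lia.
  apply: (@leq_trans (s ^ M.+1)); last exact: leq_pexp2l.
  by rewrite expnMn mulnA expnS ltn_pmul2r ?expn_gt0.
move/eqP: ax0; apply; move/(congr1 (mcoeff (mon x0))): a0.
rewrite mcoeff0 raddf_sum (bigD1 x0) //= mcoeffZ mcoeffX eqxx mulr1 big1 ?addr0 // => x xx0.
by rewrite mcoeffZ mcoeffX (inj_eq mon_inj) (negPf xx0) mulr0.
Qed.

End CommonZero.

(** * Tsen-Lang for systems of diagonal quadrics *)

Local Notation "x %:F" := (FracField.tofrac x).

Section Fractions.
Variable R : idomainType.

Lemma frac_num_den (x : {fraction R}) : exists p q : R, q != 0 /\ q%:F * x = p%:F.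
Proof.
elim/quotW: x => x; exists x.1, x.2; split; first exact: denom_ratioP.
unlock FracField.tofrac; rewrite -[LHS]FracField.pi_mul.
apply/eqmodP; rewrite /= FracField.equivfE /FracField.mulf.
by rewrite !numden_Ratio ?mulf_neq0 ?oner_eq0 ?denom_ratioP // mulr1 !mul1r mulrC.
Qed.

Lemma common_denominator (I : finType) (x : I -> {fraction R}) :
  exists (d : R) (p : I -> R), d != 0 /\ forall i, d%:F * x i = (p i)%:F.
Proof.
have [p pP] := choice _ (fun i => frac_num_den (x i)).
have [q qP] := choice _ pP.
exists (\prod_i q i), (fun i => (\prod_(j | j != i) q j) * p i); split.
  by apply/prodf_neq0 => i _; case: (qP i).
move=> i; have [_ qi] := qP i.
by rewrite (bigD1 i) //= [q i * _]mulrC !tofracM -mulrA qi.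
Qed.

End Fractions.

(** The quotient [((2 * s + 2 * E) / s) ^ n] tends to [2 ^ n] as [s] grows. *)
Lemma growth_gap r n E : exists2 s,
  (0 < s)%N & (r * (2 * s + 2 * E) ^ n < (r * 2 ^ n).+1 * s ^ n)%N.
Proof.
set R := (r * 2 ^ n)%N; pose q := (R.+1 * (n * E)).+1; pose t := (q + E)%N.
exists q => //; rewrite -mulnDr expnMn mulnA -/R -/t.
(* Bernoulli's inequality [(1 - E / t) ^ k >= 1 - k * E / t] with denominators cleared, where
   [q = t - E]. *)
have bern k : (t ^ k * t <= q ^ k * t + k * E * t ^ k)%N.
  elim: k => [|k IH]; first by rewrite !expn0 addn0.
  have le : (q ^ k <= t ^ k)%N.
    by case: k {IH} => // k; rewrite leq_exp2r // leq_addr.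
  rewrite !expnS -mulnA; apply: leq_trans (leq_mul (leqnn t) IH) _.
  rewrite mulnDr; have -> : (t * (q ^ k * t) = q * q ^ k * t + E * t * q ^ k)%N.
    by rewrite {1}(erefl _ : t = q + E)%N; ring.
  have -> : (t * (k * E * t ^ k) = k * E * (t * t ^ k))%N by ring.
  by rewrite -addnA leq_add2l mulSn mulnDl leq_add2r -!mulnA !leq_mul.
have t0 : (0 < t)%N by [].
rewrite -(ltn_pmul2r t0) -!mulnA.
have h1 := leq_mul (leqnn R.+1) (bern n).
have h2 : (R.+1 * (n * E * t ^ n) < t ^ n * t)%N.
  by rewrite mulnA [X in (_ < X)%N]mulnC ltn_pmul2r ?expn_gt0 ?t0 // /t /q addSn ltnS leq_addr.
rewrite mulnDr in h1; move: h1 h2.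
by rewrite [(R.+1 * (t ^ n * t))%N]mulSn; lia.
Qed.

Section TsenLang.
Variables (K : closedFieldType) (n : nat).
Hypothesis uncountableK : uncountable K.
Notation A := {mpoly K[n]}.

(* Looking for the [v i] of degree less than [s] in each variable gives [N * s ^ n] unknown
   coefficients subject to [r * (2 * s + c) ^ n] quadratic equations. *)
Lemma tsen_lang_poly r N (a : 'I_r -> 'I_N -> A) : (r * 2 ^ n < N)%N ->
  exists v : 'I_N -> A, (exists i, v i != 0) /\ forall e, \sum_i a e i * v i ^+ 2 = 0.
Proof.
move=> rN; pose E := (\sum_e \sum_i msize (a e i))%N.
have [s s0 sP] := growth_gap r n E.
pose I := ('I_N * {ffun 'I_n -> 'I_s})%type.
pose J := ('I_r * {ffun 'I_n -> 'I_(2 * s + 2 * E)})%type.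
have JI : (#|{: J}| < #|{: I}|)%N.
  rewrite !card_prod !card_ffun !card_ord; apply: leq_trans sP _.
  by rewrite leq_mul2r rN orbT.
pose mon k (x : {ffun 'I_n -> 'I_k}) : 'X_{1..n} := [multinom (x i : nat) | i < n].
have mon_inj k : injective (@mon k).
  by move=> x y /mnmP xy; apply/ffunP => i; apply: val_inj; have := xy i; rewrite !mnmE.
pose X (i : I) : {mpoly K[#|{: I}|]} := 'X_(enum_rank i).
(* The index [j] encodes an equation and a monomial; [f j] is the coefficient of that equation at
   that monomial, with [X (i, x)] as the unknown coefficient of [v i] at [mon s x]. *)
pose f (j : 'I_#|{: J}|) : {mpoly K[#|{: I}|]} := \sum_i \sum_x \sum_y
  (a (enum_val j).1 i * 'X_[mon s x + mon s y])@_(mon _ (enum_val j).2) *: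
    (X (i, x) * X (i, y)).
have homf j : f j \is 2.-homog.
  apply: rpred_sum => i _; apply: rpred_sum => x _; apply: rpred_sum => y _.
  by apply: rpredZ; rewrite -[2%N]/(1 + 1)%N dhomogM // dhomogX /= mdeg1.
have [c [[i0 ci0] cP]] := quadrics_common_zero uncountableK homf JI.
pose v i : A := \sum_x c (enum_rank (i, x)) *: 'X_[mon s x].
exists v; split.
  have [[i x] ix] : exists ix, enum_rank ix = i0 by exists (enum_val i0); apply: enum_valK.
  exists i; apply: contraNneq ci0 => /(congr1 (mcoeff (mon s x))).
  rewrite mcoeff0 raddf_sum (bigD1 x) //= mcoeffZ mcoeffX eqxx mulr1 big1 ?addr0.
    by rewrite ix => ->.
  by move=> y yx; rewrite mcoeffZ mcoeffX (inj_eq (@mon_inj s)) (negPf yx) mulr0.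
move=> e; have -> : \sum_i a e i * v i ^+ 2 = \sum_i \sum_x \sum_y
    (c (enum_rank (i, x)) * c (enum_rank (i, y))) *: (a e i * 'X_[mon s x + mon s y]).
  apply: eq_bigr => i _; rewrite expr2 mulr_suml mulr_sumr; apply: eq_bigr => x _.
  rewrite mulr_sumr mulr_sumr; apply: eq_bigr => y _.
  by rewrite mpolyXD -!mul_mpolyC mpolyCM; ring.
apply/mpolyP => k; rewrite mcoeff0.
(* Monomials inside the box are handled by [cP]. Outside it all coefficients vanish, since the
   exponents occurring in [a e i] are at most [E]. *)
have [small|/forallPn [t big]] := altP (@forallP _ (fun t => k t < 2 * s + 2 * E)%N).
  pose g : {ffun 'I_n -> 'I_(2 * s + 2 * E)} := [ffun t => Ordinal (small t)].
  have kE : k = mon _ g by apply/mnmP => t; rewrite mnmE ffunE.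
  have := cP (enum_rank (e, g)); rewrite /f enum_rankK /= -kE => <-.
  rewrite !raddf_sum; apply: eq_bigr => i _; rewrite !raddf_sum; apply: eq_bigr => x _.
  rewrite !raddf_sum; apply: eq_bigr => y _ /=.
  by rewrite mcoeffZ mevalZ mevalM !mevalXU mulrC.
rewrite !raddf_sum big1 // => i _; rewrite !raddf_sum big1 // => x _.
rewrite !raddf_sum big1 // => y _ /=; rewrite mcoeffZ memN_msupp_eq0 ?mulr0 //.
apply: contra big; rewrite (perm_mem (msuppMX _ _)) => /mapP [m am ->].
have : (m t < msize (a e i))%N.
  by apply: leq_ltn_trans (msize_mdeg_lt am); rewrite mdegE (bigD1 t) //= leq_addr.
have : (msize (a e i) <= E)%N.
  by rewrite /E (bigD1 e) //= (bigD1 i) //= -addnA leq_addr.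
rewrite !mnmDE !mnmE; have := ltn_ord (x t); have := ltn_ord (y t).
move: (x t : nat) (y t : nat) (m t) (msize _) => xt yt mt ma; clearbody E; lia.
Qed.

Lemma tsen_lang r N (a : 'I_r -> 'I_N -> {fraction A}) : (r * 2 ^ n < N)%N ->
  exists v : 'I_N -> {fraction A},
    (exists i, v i != 0) /\ forall e, \sum_i a e i * v i ^+ 2 = 0.
Proof.
move=> rN; have [d [p [d0 pP]]] := common_denominator (fun ei => a ei.1 ei.2).
have [v [[i vi] vP]] := tsen_lang_poly (fun e i => p (e, i)) rN.
exists (fun i => (v i)%:F); split; first by exists i; rewrite tofrac_eq0.
move=> e; have d0' : d%:F != 0 by rewrite tofrac_eq0.
apply: (mulfI d0'); rewrite mulr0 mulr_sumr.
transitivity ((\sum_i p (e, i) * v i ^+ 2)%:F); last by rewrite vP tofrac0.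
rewrite rmorph_sum.
by apply: eq_bigr => j _; rewrite /= tofracM tofracXn -(pP (e, j)) mulrA.
Qed.

End TsenLang.

(** * Isometries of diagonal forms and Pfister forms *)

Section Isometry.
Variable K : fieldType.
Implicit Types (s t l p : seq K) (n k : nat).

(** The size is a parameter separate from the lists, so that block sums of size [k + n] need no
    casts. *)
Definition congruent n s t :=
  exists P : 'M[K]_n, P \in unitmx /\ P *m gram n s *m P^T = gram n t.

Lemma gram_cat k n s t : size s = k ->
  gram (k + n) (s ++ t) = block_mx (gram k s) 0 0 (gram n t).
Proof.
move=> sk; apply/matrixP => i j; rewrite !mxE.
case: splitP => i' ii'; rewrite !mxE; case: splitP => j' jj'; rewrite !mxE.
- by rewrite -!val_eqE /= ii' jj' nth_cat sk ltn_ord.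
- by rewrite -val_eqE /= ii' jj'; case: eqP => // e; have := ltn_ord i'; lia.
- by rewrite -val_eqE /= ii' jj'; case: eqP => // e; have := ltn_ord j'; lia.
- rewrite -!val_eqE /= ii' jj' eqn_add2l nth_cat sk ltnNge leq_addr /=.
  by rewrite addnC addnK.
Qed.

Lemma congruent_cat k n s1 t1 s2 t2 : size s1 = k -> size t1 = k ->
  congruent k s1 t1 -> congruent n s2 t2 -> congruent (k + n) (s1 ++ s2) (t1 ++ t2).
Proof.
move=> s1k t1k [P [Pu PE]] [Q [Qu QE]]; exists (block_mx P 0 0 Q); split.
  by rewrite unitmxE det_ublock unitrM -!unitmxE Pu.
rewrite !gram_cat // tr_block_mx !trmx0 !mulmx_block.
by rewrite !(mul0mx, mulmx0, addr0, add0r) PE QE.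
Qed.

Lemma congruent_refl n s : congruent n s s.
Proof. by exists 1%:M; rewrite unitmx1 mul1mx trmx1 mulmx1. Qed.

Lemma congruent1 x c : c != 0 -> congruent 1 [:: x] [:: x * c ^+ 2].
Proof.
move=> c0; exists c%:M; split; first by rewrite unitmxE det_scalar expr1 unitfE.
apply/matrixP => i j; rewrite !ord1 tr_scalar_mx mul_scalar_mx mul_mx_scalar !mxE /=.
ring.
Qed.

Lemma congruent2 (a b c d u v u' v' : K) : a * d - b * c != 0 ->
  a ^+ 2 * u + b ^+ 2 * v = u' -> c ^+ 2 * u + d ^+ 2 * v = v' ->
  a * c * u + b * d * v = 0 -> congruent 2 [:: u; v] [:: u'; v'].
Proof.
move=> det0 eu ev e0.
pose P : 'M[K]_2 := \matrix_(i, j) if i == 0 then (if j == 0 then a else b)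
  else (if j == 0 then c else d).
exists P; split.
  by rewrite unitmxE unitfE (expand_det_row _ 0) !big_ord_recl big_ord0 /cofactor
    !det_mx11 !mxE /= addr0 expr0 expr1 mul1r mulN1r mulrN.
have ord2 (i : 'I_2) : i = 0 \/ i = 1.
  by case: i => [[|[|//]] ?]; [left|right]; apply: val_inj.
apply/matrixP => i j; rewrite !mxE !big_ord_recl !big_ord0 !mxE !big_ord_recl !big_ord0 !mxE /=.
case: (ord2 i) => ->; case: (ord2 j) => -> /=; rewrite -?eu -?ev -?[RHS]e0; ring.
Qed.

(** Witt's chain equivalence. The isometries between Pfister forms below are compositions of these
    moves, so no matrices need be written for them. *)
Inductive chain : seq K -> seq K -> Prop :=
| chain_refl s : chain s s
| chain_sym s t : chain s t -> chain t s
| chain_trans s t r : chain s t -> chain t r -> chain s r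
| chain_cons x s t : chain s t -> chain (x :: s) (x :: t)
| chain_swap x y s : chain (x :: y :: s) (y :: x :: s)
| chain_scale x c s : c != 0 -> chain (x :: s) (x * c ^+ 2 :: s)
| chain_add u v s : u + v != 0 -> chain (u :: v :: s) (u + v :: (u + v) * u * v :: s).

Lemma chain_isometric s t : chain s t -> isometric s t.
Proof.
move=> st; suff: size s = size t /\ congruent (size s) s t by [].
elim: {s t} st => //.
- by move=> s; split=> //; apply: congruent_refl.
- move=> s t _ [st [P [Pu PE]]]; split=> //; rewrite -st.
  exists (invmx P); split; first by rewrite unitmx_inv.
  rewrite -PE !mulmxA mulVmx // mul1mx -mulmxA -trmx_mul mulVmx //.
  by rewrite trmx1 mulmx1.
- move=> s t r _ [st [P [Pu PE]]] _ [tr [Q [Qu QE]]]; split; first by rewrite st.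
  rewrite -st in Q Qu QE; exists (Q *m P); split; first by rewrite unitmx_mul Qu.
  by rewrite trmx_mul !mulmxA -[Q *m P *m _]mulmxA -[Q *m _ *m _]mulmxA PE.
- move=> x s t _ [st c]; split; first by rewrite /= st.
  by apply: (@congruent_cat 1 (size s) [:: x] [:: x]) => //; apply: congruent_refl.
- move=> x y s; split=> //; apply: (@congruent_cat 2 (size s) [:: x; y] [:: y; x]) => //.
    by apply: (@congruent2 0 1 1 0); rewrite ?mul0r ?mul1r ?sub0r ?oppr_eq0 ?oner_eq0 //; ring.
  exact: congruent_refl.
- move=> x c s c0; split=> //; apply: (@congruent_cat 1 (size s) [:: x] [:: _]) => //.
    exact: congruent1.
  exact: congruent_refl.
move=> u v s uv; split=> //; apply: (@congruent_cat 2 (size s) [:: u; v] [:: _; _]) => //.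
  (* The new orthogonal basis is [e_1 + e_2] and [- v e_1 + u e_2], with values [u + v] and
     [(u + v) u v]. *)
  apply: (@congruent2 1 1 (- v) u); try ring.
  by rewrite mul1r mulrN mul1r opprK.
exact: congruent_refl.
Qed.

Lemma chain_cat s1 t1 s2 t2 : chain s1 t1 -> chain s2 t2 -> chain (s1 ++ s2) (t1 ++ t2).
Proof.
move=> c1 c2; apply: (@chain_trans _ (s1 ++ t2)).
  by elim: s1 {c1} => //= x s IH; apply: chain_cons.
elim: c1 => {s1 t1 c2} /=.
- by move=> s; apply: chain_refl.
- by move=> s t _; apply: chain_sym.
- by move=> s t r _ h1 _; apply: chain_trans.
- by move=> x s t _; apply: chain_cons.
- by move=> x y s; apply: chain_swap.
- by move=> x c s; apply: chain_scale.
- by move=> u v s; apply: chain_add.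
Qed.

Lemma chain_perm s t : perm_eq s t -> chain s t.
Proof.
elim: s t => [|x s IH] t; first by rewrite perm_sym => /perm_nilP ->; apply: chain_refl.
move=> st; have xt : x \in t by rewrite -(perm_mem st) mem_head.
case/splitPr: xt st => t1 t2 st.
have {}st : perm_eq s (t1 ++ t2).
  by rewrite -(perm_cons x) (permPl st) -cat1s perm_catCA.
apply: chain_trans (chain_cons x (IH _ st)) _.
elim: t1 {st IH} => [|y t1 IH] /=; first exact: chain_refl.
exact: chain_trans (chain_swap _ _ _) (chain_cons y IH).
Qed.

Definition sc (c : K) s := [seq c * x | x <- s].

Lemma sc_cat c s t : sc c (s ++ t) = sc c s ++ sc c t.
Proof. exact: map_cat. Qed.

Lemma scA a b s : sc a (sc b s) = sc (a * b) s.
Proof. by rewrite /sc -map_comp; apply: eq_map => x /=; rewrite mulrA. Qed.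

Lemma chain_sc c s t : c != 0 -> chain s t -> chain (sc c s) (sc c t).
Proof.
move=> c0; elim => {s t} /=.
- by move=> s; apply: chain_refl.
- by move=> s t _; apply: chain_sym.
- by move=> s t r _ h1 _; apply: chain_trans.
- by move=> x s t _; apply: chain_cons.
- by move=> x y s; apply: chain_swap.
- by move=> x d s d0; rewrite mulrA; apply: chain_scale.
move=> u v s uv; rewrite mulrDr.
apply: chain_trans (chain_add _ _) _; first by rewrite -mulrDr mulf_neq0.
apply: chain_cons; rewrite -mulrDr -/(sc c s).
have -> : c * (u + v) * (c * u) * (c * v) = c * ((u + v) * u * v) * c ^+ 2 by ring.
exact/chain_sym/chain_scale.
Qed.

Lemma chain_sc_square c s : c != 0 -> chain s (sc (c ^+ 2) s).
Proof.
move=> c0; elim: s => [|x s IH] /=; first exact: chain_refl.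
rewrite [_ * x]mulrC; exact: chain_trans (chain_cons _ IH) (chain_scale _ _ c0).
Qed.

Lemma chain_sc_add u v s : all (fun x => x != 0) s -> u + v != 0 ->
  chain (sc u s ++ sc v s) (sc (u + v) s ++ sc ((u + v) * u * v) s).
Proof.
move=> s0 uv; elim: s s0 => [|x s IH] /=; first by move=> _; apply: chain_refl.
move=> /andP [x0 /IH {}IH].
have cA a b (r r' : seq K) : chain ((a :: r) ++ b :: r') (a :: b :: r ++ r').
  by apply: chain_perm; rewrite /= perm_cons -cat1s perm_catCA.
apply: chain_trans (cA _ _ _ _) _; apply: chain_trans _ (chain_sym (cA _ _ _ _)).
apply: chain_trans (chain_cons _ (chain_cons _ IH)) _.
apply: chain_trans (chain_add _ _) _; first by rewrite -mulrDl mulf_neq0.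
rewrite -mulrDl; apply: chain_cons.
have -> : (u + v) * x * (u * x) * (v * x) = (u + v) * u * v * x * x ^+ 2 by ring.
exact/chain_sym/chain_scale.
Qed.

Fixpoint repr s v : Prop := if s is x :: s' then exists w, repr s' (v - x * w ^+ 2) else v = 0.

Lemma reprP s v : repr s v <-> exists w : nat -> K, v = \sum_(i < size s) s`_i * w i ^+ 2.
Proof.
elim: s v => [|x s IH] v /=.
  by split=> [->|[w ->]]; [exists (fun=> 0)|]; rewrite big_ord0.
split=> [[y /IH [w wE]]|[w ->]].
  exists (fun i => if i is i'.+1 then w i' else y).
  by rewrite big_ord_recl /= -wE addrC subrK.
exists (w 0%N); apply/IH; exists (fun i => w i.+1).
by rewrite big_ord_recl /= addrC addKr.
Qed.

Lemma chain_repr s t v : chain s t -> repr s v <-> repr t v.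
Proof.
move=> st; elim: st v => {s t} //=.
- by move=> s t _ IH v; rewrite IH.
- by move=> s t r _ IH1 _ IH2 v; rewrite IH1.
- by move=> x s t _ IH v; split=> -[w]; exists w; apply/IH.
- by move=> x y s v; split=> -[a [b]]; exists b, a; rewrite addrAC.
- move=> x c s c0 v; split=> -[w wP].
    exists (w / c); congr (repr s (v - _)): wP; by field.
  exists (w * c); congr (repr s (v - _)): wP; by ring.
move=> u v s uv z; split=> -[a [b ab]].
  exists ((u * a + v * b) / (u + v)), ((b - a) / (u + v)).
  by congr (repr s _): ab; field.
by exists (a - v * b), (a + u * b); congr (repr s _): ab; ring.
Qed.

Lemma repr_cat s t v :
  repr (s ++ t) v <-> exists v1 v2, [/\ repr s v1, repr t v2 & v = v1 + v2].
Proof.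
elim: s v => [|x s IH] v /=.
  by split=> [tv|[_ [v2 [-> ? ->]]]]; [exists 0, v|]; rewrite add0r.
split=> [[w /IH [v1 [v2 [s1 t2 e]]]]|[v1 [v2 [[w s1] t2 e]]]].
  exists (v1 + x * w ^+ 2), v2; split=> //; first by exists w; rewrite addrK.
  by rewrite addrAC -e subrK.
by exists w; apply/IH; exists (v1 - x * w ^+ 2), v2; split=> //; rewrite e addrAC.
Qed.

Lemma repr_sc c s v : repr (sc c s) v <-> exists2 v', repr s v' & v = c * v'.
Proof.
elim: s v => [|x s IH] v /=.
  by split=> [->|[_ -> ->]]; [exists 0|]; rewrite ?mulr0.
split=> [[w /IH [v' sv' e]]|[v' [w sv'] ->]].
  exists (v' + x * w ^+ 2); first by exists w; rewrite addrK.
  by rewrite mulrDr mulrA -e subrK.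
by exists w; apply/IH; exists (v' - x * w ^+ 2) => //; ring.
Qed.

(** * Roundness of Pfister forms and change of slots *)

Section Pfister.

Definition nz s := all (fun x => x != 0) s.

Lemma nz_sc c s : c != 0 -> nz s -> nz (sc c s).
Proof. by move=> c0; rewrite /nz all_map; apply: sub_all => x x0; rewrite /= mulf_neq0. Qed.

Lemma perm_pf_cons a l : perm_eq (pf (a :: l)) (pf l ++ sc (- a) (pf l)).
Proof.
rewrite [pf (_ :: _)]/= /tens; elim: (pf l) => // x s IH /=.
by rewrite mulr1 [x * _]mulrC perm_cons perm_sym -cat1s perm_catCA /= perm_cons perm_sym.
Qed.

Lemma pf_cons a l : chain (pf (a :: l)) (pf l ++ sc (- a) (pf l)).
Proof. exact/chain_perm/perm_pf_cons. Qed.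

Lemma nz_pf l : nz l -> nz (pf l).
Proof.
elim: l => [_|a l IH]; first by rewrite /nz /= oner_eq0.
case/andP => a0 /IH.
rewrite [pf (_ :: _)]/= /tens. elim: (pf l) => [|x s IHs] //.
case/andP => x0 /IHs s0; rewrite /nz /=.
by rewrite mulr1 x0 mulrN oppr_eq0 mulf_neq0.
Qed.

Lemma size_pf l : size (pf l) = (2 ^ size l)%N.
Proof. by elim: l => //= a l IH; rewrite size_allpairs IH expnS mulnC. Qed.

Lemma chain_pf_cons a l l' : a != 0 -> chain (pf l) (pf l') -> chain (pf (a :: l)) (pf (a :: l')).
Proof.
move=> a0 ll'; apply: chain_trans (pf_cons _ _) _.
apply: chain_trans _ (chain_sym (pf_cons _ _)).
by apply: chain_cat => //; apply: chain_sc; rewrite ?oppr_eq0.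
Qed.

Lemma chain_pf_cat p l l' : nz p -> chain (pf l) (pf l') -> chain (pf (p ++ l)) (pf (p ++ l')).
Proof. by move=> + ll'; elim: p => //= a p IH /andP [a0 /IH]; apply: chain_pf_cons. Qed.

Lemma pf_cons2 a b l : chain (pf (a :: b :: l))
  ((pf l ++ sc (- b) (pf l)) ++ sc (- a) (pf l) ++ sc (a * b) (pf l)).
Proof.
apply: chain_trans (pf_cons _ _) _.
have [->|a0] := eqVneq a 0.
  apply: chain_cat; first exact: pf_cons.
  rewrite mul0r oppr0; apply: chain_perm.
  have scE s : sc 0 s = nseq (size s) 0.
    by elim: s => //= x s ->; rewrite mul0r.
  rewrite !scE cat_nseq /ncons -iterD -/(ncons _ _ _) -cat_nseq cats0.
  by rewrite !size_pf /= expnS mul2n addnn.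
apply: chain_cat; first exact: pf_cons.
rewrite -[a * b]mulrNN -scA -sc_cat; apply: chain_sc; first by rewrite oppr_eq0.
exact: pf_cons.
Qed.

Lemma chain_pf_swap a b l : chain (pf (a :: b :: l)) (pf (b :: a :: l)).
Proof.
apply: chain_trans (pf_cons2 _ _ _) (chain_trans _ (chain_sym (pf_cons2 _ _ _))).
rewrite [b * a]mulrC; apply: chain_perm.
by rewrite -!catA perm_cat2l perm_catCA.
Qed.

Lemma chain_pf_move a p l : nz p -> chain (pf (a :: p ++ l)) (pf (p ++ a :: l)).
Proof.
elim: p => [|b p IH] /=; first by move=> _; apply: chain_refl.
case/andP => b0 /IH h; apply: chain_trans (chain_pf_swap _ _ _) _.
exact: chain_pf_cons.
Qed.

(** Write [c = c1 - a * c2] with values [c1], [c2] of [pf l]. If both are nonzero, induction turns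
    [<1, -a>] into [<c1, -a c2>], then into [<c, -a c c1 c2>] and finally into [c <1, -a>], all
    tensored with [pf l]. If one is zero, [c] is the other term alone. *)
Lemma pf_round l c : nz l -> c != 0 -> repr (pf l) c -> chain (sc c (pf l)) (pf l).
Proof.
elim: l c => [|a l IH] c; first move=> _ c0 [w /eqP].
  rewrite mul1r subr_eq0 => /eqP cw; rewrite cw /= mulr1.
  have w0 : w != 0 by apply: contraNneq c0 => w0; rewrite cw w0 expr0n.
  by rewrite -[X in chain [:: X]]mul1r; apply/chain_sym/chain_scale.
case/andP => a0 l0 c0; rewrite (chain_repr _ (pf_cons a l)) => /repr_cat.
case=> c1 [_ [rc1 /repr_sc [c2 rc2 ->] ce]].
have a0' : - a != 0 by rewrite oppr_eq0.
apply: chain_trans (chain_sc c0 (pf_cons a l)) _.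
apply: chain_trans _ (chain_sym (pf_cons a l)); rewrite sc_cat scA.
have [c20|c20] := eqVneq c2 0.
  have e : c = c1 by rewrite ce c20 mulr0 addr0.
  have cl : chain (sc c (pf l)) (pf l) by apply: IH => //; rewrite e.
  by apply: chain_cat => //; rewrite mulrC -scA; apply: chain_sc.
have c2l := IH _ l0 c20 rc2.
have [c10|c10] := eqVneq c1 0.
  have e : c = - a * c2 by rewrite ce c10 add0r.
  apply: (@chain_trans _ (sc (- a) (pf l) ++ pf l)); last first.
    by apply: chain_perm; rewrite perm_catC.
  rewrite e; apply: chain_cat; first by rewrite -scA; apply: chain_sc.
  have -> : - a * c2 * - a = a ^+ 2 * c2 by ring.
  rewrite -scA; apply: chain_trans (chain_sc _ c2l) _; first by rewrite expf_neq0.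
  exact/chain_sym/chain_sc_square.
have c1l := IH _ l0 c10 rc1.
apply: chain_sym; apply: (@chain_trans _ (sc c1 (pf l) ++ sc (- a * c2) (pf l))).
  apply: chain_cat; first exact: chain_sym.
  by rewrite -scA; apply: chain_sc => //; apply: chain_sym.
apply: chain_trans (chain_sc_add _ _) _; first exact: nz_pf.
  by rewrite -ce.
rewrite -ce; apply: chain_cat; first exact: chain_refl.
have -> : c * c1 * (- a * c2) = c * - a * (c1 * c2) by ring.
rewrite -(scA _ (c1 * c2)); apply: chain_sc; first by rewrite mulf_neq0.
by rewrite -scA; apply: chain_trans (chain_sc c10 c2l) c1l.
Qed.

Lemma chain_pf_mulr a c l : a != 0 -> nz l -> c != 0 -> repr (pf l) c ->
  chain (pf (a :: l)) (pf (a * c :: l)).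
Proof.
move=> a0 l0 c0 lc; apply: chain_trans (pf_cons _ _) _.
apply: chain_trans _ (chain_sym (pf_cons _ _)).
apply: chain_cat; first exact: chain_refl.
rewrite -mulNr -scA; apply: chain_sc; first by rewrite oppr_eq0.
exact/chain_sym/pf_round.
Qed.

(** In [<1, -u, -v, u v>] the middle pair is replaced by [-(u + v) <1, u v>]. *)
Lemma chain_pf_add u v l : nz l -> u + v != 0 ->
  chain (pf (u :: v :: l)) (pf (- (u * v) :: u + v :: l)).
Proof.
move=> l0 uv; apply: chain_trans (pf_cons2 _ _ _) _.
apply: chain_trans _ (chain_sym (pf_cons2 _ _ _)).
rewrite -!catA; apply: chain_cat; first exact: chain_refl.
have := @chain_sc_add (- u) (- v) (pf l) (nz_pf l0).
rewrite -opprD oppr_eq0 => /(_ uv) h.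
apply: (@chain_trans _ ((sc (- u) (pf l) ++ sc (- v) (pf l)) ++ sc (u * v) (pf l))).
  by apply: chain_perm; rewrite -catA perm_catCA.
apply: chain_trans (chain_cat h (chain_refl _)) _.
rewrite -catA; apply: chain_cat; first exact: chain_refl.
have -> : - (u + v) * - u * - v = - (u * v) * (u + v) by ring.
by rewrite opprK; apply: chain_perm; rewrite perm_catC.
Qed.

(* The complement of [pf p] in [pf (l ++ p)]. *)
Fixpoint pure l p : seq K := if l is a :: l' then pure l' p ++ sc (- a) (pf (l' ++ p)) else [::].

Lemma nz_pure l p : nz l -> nz p -> nz (pure l p).
Proof.
elim: l => //= a l IH /andP [a0 l0] p0; rewrite /nz all_cat -!/(nz _) IH //=.
by rewrite nz_sc ?oppr_eq0 // nz_pf // /nz all_cat -!/(nz _) l0.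
Qed.

Lemma size_pure l p : (size (pure l p) + 2 ^ size p = 2 ^ (size l + size p))%N.
Proof.
elim: l => //= a l IH; rewrite size_cat size_map size_pf size_cat addSn expnS; lia.
Qed.

(** A relative version of the pure subform theorem. Write [d = a * e - v1] with [e] a value of
    [pf (l ++ p)] and [- v1] a slot available by induction. Roundness changes the slot [a] into
    [a * e], and [chain_pf_add] merges the slots [a * e] and [- v1] into one equal to [d]. The cases
    [e = 0] and [v1 = 0] use one of the two slots. *)
Lemma pf_extract l p d : nz l -> nz p -> d != 0 -> repr (pure l p) (- d) ->
  exists l', [/\ (size l').+1 = size l, nz l' & chain (pf (l ++ p)) (pf (l' ++ d :: p))].
Proof.
elim: l d => [|a l IH] d /=; first by move=> _ _ d0 /eqP; rewrite oppr_eq0 (negPf d0).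
case/andP => a0 l0 p0 d0 /repr_cat [v1 [_ [r1 /repr_sc [e re ->] de]]].
have {de} de : d = - v1 + a * e by rewrite -[d]opprK de opprD mulNr opprK.
have lp0 : nz (l ++ p) by rewrite /nz all_cat -!/(nz _) l0.
have [e0|e0] := eqVneq e 0.
  have dv : - d = v1 by rewrite de e0 mulr0 addr0 opprK.
  have [|l' [sl' l'0 c]] := IH d l0 p0 d0; first by rewrite dv.
  exists (a :: l'); split; rewrite /= ?sl' ?a0 //.
  exact: chain_pf_cons.
have c1 := chain_pf_mulr a0 lp0 e0 re.
have [v0|v0] := eqVneq v1 0.
  have dE : d = a * e by rewrite de v0 oppr0 add0r.
  exists l; split=> //; apply: chain_trans c1 _; rewrite -dE.
  exact: chain_pf_move.
have nv0 : - v1 != 0 by rewrite oppr_eq0.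
have [|l' [sl' l'0 c]] := IH (- v1) l0 p0 nv0; first by rewrite opprK.
have ae0 : a * e != 0 by rewrite mulf_neq0.
exists (l' ++ [:: - (a * e * - v1)]); split.
- by rewrite size_cat addn1 sl'.
- by rewrite /nz all_cat -/(nz _) l'0 /= oppr_eq0 mulf_neq0.
apply: chain_trans c1 _; apply: chain_trans (chain_pf_cons ae0 c) _.
apply: chain_trans (chain_pf_move _ _ l'0) _; rewrite -catA.
apply: chain_pf_cat => //; have -> : d = a * e - v1 by rewrite de addrC.
by apply: chain_pf_add => //; rewrite addrC -de.
Qed.

End Pfister.

Section Isotropy.
Hypothesis two_neq0 : (2%:R : K) != 0.

Definition isotropic s := exists w : nat -> K,
  (exists2 i, (i < size s)%N & w i != 0) /\ \sum_(i < size s) s`_i * w i ^+ 2 = 0.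

(** Adding the [i]-th basis vector to [t] times an isotropic vector [w] gives the value
    [2 t s_i w_i + s_i], which is linear in [t]. *)
Lemma isotropic_universal s v : nz s -> isotropic s -> repr s v.
Proof.
move=> s0 [w [[i si wi] w0]]; apply/reprP.
have x0 : s`_i != 0 by move/(all_nthP 0): s0; apply.
pose t := (v - s`_i) / (2%:R * s`_i * w i).
exists (fun j => t * w j + (j == i)%:R).
have -> : \sum_(j < size s) s`_j * (t * w j + (j == i :> nat)%:R) ^+ 2 =
    \sum_(j < size s) (t ^+ 2 * (s`_j * w j ^+ 2) +
      (j == Ordinal si)%:R * (2%:R * t * s`_i * w i + s`_i)).
  apply: eq_bigr => j _; rewrite -val_eqE /=; case: eqP => [->|_] /=; ring.
rewrite big_split /= -mulr_sumr w0 mulr0 add0r (bigD1 (Ordinal si)) //= eqxx big1.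
  rewrite /= mul1r addr0. by rewrite /t; field; rewrite x0 wi two_neq0.
by move=> j /negPf ->; rewrite mul0r.
Qed.

End Isotropy.

End Isometry.

(** * Triple linkage *)

Section Linkage.
Variables (K : fieldType) (n : nat).
Hypothesis two_neq0 : (2%:R : K) != 0.
Hypothesis tsen : forall r N (a : 'I_r -> 'I_N -> K), (r * 2 ^ n < N)%N ->
  exists v : 'I_N -> K, (exists i, v i != 0) /\ forall e, \sum_i a e i * v i ^+ 2 = 0.

Lemma tsen_fin (E V : finType) (a : E -> V -> K) : (#|E| * 2 ^ n < #|V|)%N ->
  exists v : V -> K, (exists i, v i != 0) /\ forall e, \sum_i a e i * v i ^+ 2 = 0.
Proof.
move=> EV; have [v [[i vi] vP]] := tsen (fun (e : 'I_#|E|) (i : 'I_#|V|) =>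
  a (enum_val e) (enum_val i)) EV.
exists (fun x => v (enum_rank x)); split; first by exists (enum_val i); rewrite enum_valK.
move=> e; rewrite -[RHS](vP (enum_rank e)) [RHS](reindex (@enum_rank V)) /=.
  by apply: eq_bigr => x _; rewrite !enum_rankK.
exact: onW_bij (enum_rank_bij V).
Qed.

(* Isotropic forms are universal; for the others, equality of the values is a system of
   one equation fewer than there are forms, and its zeros cannot give the value [0]. *)
Lemma common_value m N (s : 'I_m -> seq K) : (forall j, size (s j) = N) ->
  (forall j, nz (s j)) -> ((m - 1) * 2 ^ n < m * N)%N ->
  exists2 d, d != 0 & forall j, repr (s j) d.
Proof.
move=> sN s0 mN.
pose iso j : bool := excluded_middle_informative (isotropic (s j)).
have isoP j : iso j -> isotropic (s j) by rewrite /iso; case: excluded_middle_informative.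
have anisoP j : ~~ iso j -> ~ isotropic (s j).
  by rewrite /iso; case: excluded_middle_informative.
have univ j d : iso j -> repr (s j) d.
  by move=> /isoP h; apply: isotropic_universal.
have [j0 aj0|all_iso] := pickP (fun j => ~~ iso j); last first.
  by exists 1; rewrite ?oner_eq0 // => j; apply: univ; apply: negbFE (all_iso j).
pose T := {j | ~~ iso j}; pose E := {j : T | val j != j0}.
have cardET : #|{: E}|.+1 = #|{: T}|.
  rewrite [in LHS]card_sig [in RHS](cardD1 (Sub j0 aj0 : T)) inE /= add1n; congr _.+1.
  by apply: eq_card => j; rewrite !inE andbT.
(* Equation [e] says that the forms with index [e] and [j0] take the same value. *)
pose coef (e : E) (x : T * 'I_N) : K := (s (val x.1))`_x.2 *
  ((x.1 == val e)%:R - (val x.1 == j0)%:R).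
have [|v [[[j1 i1] v1] vP]] := @tsen_fin {: E} {: T * 'I_N} coef.
  (* The inequality assumed for [m] forms persists for the anisotropic ones among them: it is clear
     for [N >= 2 ^ n], and otherwise reads [m * (2 ^ n - N) < 2 ^ n]. *)
  have cT : (#|{: T}| <= m)%N by rewrite card_sig -[X in (_ <= X)%N]card_ord max_card.
  rewrite card_prod card_ord; move: cT; rewrite -cardET.
  move: #|_| (2 ^ n)%N (expn_gt0 2 n) (mN) => x q q0 mN0 /subnKC.
  move: (m - x.+1)%N => y my; rewrite -my in mN0; clear -q0 mN0.
  by rewrite addSn subn1 /= in mN0; have [] := leqP q N; nia.
pose val_ (j : T) := \sum_(i < N) (s (val j))`_i * v (j, i) ^+ 2.
have coefE (e : E) : val_ (val e) = val_ (Sub j0 aj0).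
  have : \sum_(j : T) ((j == val e)%:R - (val j == j0)%:R) * val_ j = 0.
    rewrite -[RHS](vP e).
    transitivity (\sum_(j : T) \sum_(i < N) coef e (j, i) * v (j, i) ^+ 2).
      by apply: eq_bigr => j _; rewrite mulr_sumr; apply: eq_bigr => i _; rewrite /coef /=; ring.
    by rewrite pair_bigA; apply: eq_bigr => -[].
  under eq_bigr => j _ do rewrite mulrBl.
  rewrite sumrB (bigD1 (val e)) //= eqxx mul1r big1 ?addr0 => [|j /negPf ->]; last by rewrite mul0r.
  rewrite (bigD1 (Sub j0 aj0 : T)) //= eqxx mul1r big1 ?addr0 => [|j].
    by move/eqP; rewrite subr_eq0 => /eqP.
  by rewrite -val_eqE /= => /negPf ->; rewrite mul0r.
have vE (j : T) : val_ j = val_ (Sub j0 aj0).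
  have [jj0|jj0] := boolP (val j == j0); last exact: (coefE (Sub j jj0)).
  by congr val_; apply: val_inj; rewrite /= (eqP jj0).
have ext (j : T) : exists w : nat -> K, forall i : 'I_N, w i = v (j, i).
  exists (fun k => if insub k is Some i then v (j, i) else 0) => i.
  by rewrite valK.
exists (val_ (Sub j0 aj0)).
  apply/negP => /eqP d0; apply: (anisoP _ (valP j1)).
  have [w wE] := ext j1; exists w; rewrite sN; split; first by exists i1; rewrite ?wE.
  by rewrite -[RHS]d0 -(vE j1); apply: eq_bigr => i _; rewrite wE.
move=> j; have [/univ //|aj] := boolP (iso j).
apply/reprP; have [w wE] := ext (Sub j aj); exists w; rewrite sN -(vE (Sub j aj)).
by apply: eq_bigr => i _; rewrite wE.
Qed.

(** The common factor grows by one slot at a time. The numerical hypothesis, which for positive [m]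
    says [m < 4], is the count for the last step [k = n - 2], where the complements are smallest. *)
Lemma common_factor m (l : 'I_m -> seq K) k : (m * 2 ^ n > (m - 1) * 2 ^ n + m * 2 ^ n.-2)%N ->
  (2 <= n)%N -> (k < n)%N ->
  (forall j, size (l j) = n) -> (forall j, nz (l j)) ->
  exists (p : seq K) (t : 'I_m -> seq K), [/\ size p = k, nz p,
    forall j, size (t j) = (n - k)%N /\ nz (t j)
    & forall j, chain (pf (l j)) (pf (t j ++ p))].
Proof.
move=> mn n2 + ln l0; elim: k => [|k IH] kn.
  exists [::], l; split=> // j; first by rewrite subn0.
  by rewrite cats0; apply: chain_refl.
have [p [t [pk p0 tP ct]]] := IH (ltnW kn).
pose s j := pure (t j) p.
have kn2 : (2 ^ k <= 2 ^ n.-2)%N by rewrite leq_exp2l //; lia.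
have [|||d d0 dP] := @common_value m (2 ^ n - 2 ^ k)%N s.
- move=> j; rewrite /s; have := size_pure (t j) p; have [-> _] := tP j.
  by rewrite pk (subnK (ltnW (ltnW kn))) => <-; rewrite addnK.
- by move=> j; apply: nz_pure => //; case: (tP j).
- rewrite mulnBr; have := leq_mul (leqnn m) kn2; lia.
have [t' t'P] : exists t' : 'I_m -> seq K, forall j, [/\ (size (t' j)).+1 = size (t j), nz (t' j)
    & chain (pf (t j ++ p)) (pf (t' j ++ - d :: p))].
  apply: (choice (fun j t' => [/\ (size t').+1 = size (t j), nz t'
    & chain (pf (t j ++ p)) (pf (t' ++ - d :: p))])) => j.
  have [sj tj] := tP j; apply: pf_extract => //; first by rewrite oppr_eq0.
  by rewrite opprK; apply: dP.
exists (- d :: p), t'; split; rewrite /= ?pk ?oppr_eq0 ?d0 //.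
  move=> j; have [e -> _] := t'P j; split=> //; move: e; have [-> _] := tP j; lia.
by move=> j; have [_ _ c] := t'P j; apply: chain_trans (ct j) c.
Qed.

Lemma linked3 : (2 <= n)%N -> m_linked K 3 n.
Proof.
move=> n2 phi pfphi; have [l lP] := choice _ pfphi.
have [||||p [t [pn p0 tP ct]]] := @common_factor 3 l n.-1 _ n2.
- have -> : (2 ^ n = 4 * 2 ^ n.-2)%N by rewrite -(expnD 2 2); congr expn; lia.
  by have := expn_gt0 2 n.-2; lia.
- by lia.
- by move=> j; case: (lP j).
- by move=> j; case: (lP j) => _ [].
exists (pf p); split; first by exists p.
have tj j : exists2 b, b != 0 & t j = [:: b].
  have [] := tP j; have -> : (n - n.-1 = 1)%N by lia.
  by case: (t j) => [|b [|]] // _ /andP [b0 _]; exists b.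
exists (fun j => head 0 (t j)); split=> j; have [b b0 e] := tj j; first by rewrite e.
by have [_ [_ ->]] := lP j; apply: chain_isometric; have := ct j; rewrite e.
Qed.

End Linkage.

(** * Quadratic relations modulo 2 *)

Section OddDeterminant.
Variables (K : numFieldType) (I : finType) (c : I -> K).

(** The additive group generated by the products of two coefficients; congruences modulo 2 are taken
    in it, in place of a ring of dyadic integers. *)
Definition quadspan (x : K) := exists z : I -> I -> int,
  x = \sum_a \sum_b (z a b)%:~R * (c a * c b).

Lemma quadspan_gen a b : quadspan (c a * c b).
Proof.
exists (fun a' b' => ((a' == a) && (b' == b))%:R).
rewrite (bigD1 a) //= (bigD1 b) //= !eqxx mul1r !big1 ?addr0 //.
  by move=> a' /negPf ->; rewrite big1 // => b' _; rewrite mul0r.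
by move=> b' /negPf ->; rewrite mul0r.
Qed.

Lemma quadspan0 : quadspan 0.
Proof.
by exists (fun _ _ => 0); rewrite big1 // => a _; rewrite big1 // => b _; rewrite mul0r.
Qed.

Lemma quadspanB x y : quadspan x -> quadspan y -> quadspan (x - y).
Proof.
move=> [z ->] [z' ->]; exists (fun a b => z a b - z' a b).
rewrite -sumrB; apply: eq_bigr => a _; rewrite -sumrB; apply: eq_bigr => b _.
by rewrite rmorphB mulrBl.
Qed.

(* The products [w] of [#|I| + 1] of the [c a] satisfy [w = 2 M w] with [M] integral, and
   [det (1 - 2 M)] is odd. *)
Lemma even_squares_eq0 :
  (forall a, exists2 y, quadspan y & c a ^+ 2 = 2%:R * y) -> forall a, c a = 0.
Proof.
move=> even a0; pose T := {ffun 'I_#|I|.+1 -> I}.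
pose w (f : T) := \prod_i c (f i).
have span (f : T) : exists M : T -> int, w f = 2%:R * \sum_g (M g)%:~R * w g.
  (* Among [#|I| + 1] factors two coincide; their product is a square [c a ^+ 2], to which the
     hypothesis applies. *)
  have /injectivePn [i [j ij fij]] : ~~ injectiveb f.
    apply/negP => /injectiveP /leq_card; rewrite card_ord; lia.
  have [_ [z ->] cE] := even (f i).
  pose g a b : T := [ffun k => if k == i then a else if k == j then b else f k].
  have gE a b : w (g a b) = c a * c b * \prod_(k | (k != i) && (k != j)) c (f k).
    rewrite /w (bigD1 i) //= (bigD1 j) 1?eq_sym //= !ffunE !eqxx [j == i]eq_sym (negPf ij).
    rewrite mulrA; congr (_ * _); apply: eq_bigr => k /andP [/negPf ki /negPf kj].
    by rewrite ffunE ki kj.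
  have -> : w f = w (g (f i) (f i)).
    by congr w; apply/ffunP => k; rewrite ffunE; case: eqP => [->|_] //; case: eqP => [->|].
  exists (fun h => \sum_a \sum_b z a b * (h == g a b)%:R).
  rewrite gE -expr2 cE -mulrA; congr (_ * _); rewrite mulr_suml.
  under [RHS]eq_bigr => h _ do rewrite rmorph_sum mulr_suml.
  rewrite [RHS]exchange_big; apply: eq_bigr => a _ /=; rewrite mulr_suml.
  under [RHS]eq_bigr => h _ do rewrite rmorph_sum mulr_suml.
  rewrite [RHS]exchange_big; apply: eq_bigr => b _ /=.
  rewrite (bigD1 (g a b)) //= eqxx mulr1 [X in _ = _ + X]big1 ?addr0; first by rewrite gE !mulrA.
  by move=> h /negPf ->; rewrite mulr0 mul0r.
have [M MP] := choice _ span.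
pose A : 'M[int]_#|{: T}| := 1%:M - \matrix_(i, j) (2%:R * M (enum_val i) (enum_val j)).
have detA : \det A != 0.
  apply/eqP => /(congr1 (intr : int -> 'F_2)); rewrite -det_map_mx.
  have -> : map_mx (intr : int -> 'F_2) A = 1%:M.
    apply/matrixP => i j; rewrite !mxE rmorphB rmorphM /= [X in X * _](_ : _ = 0) ?mul0r ?subr0.
      by case: eqP.
    by apply: val_inj.
  by rewrite det1.
pose v : 'cV[K]_#|{: T}| := \col_i w (enum_val i).
have Av : map_mx (intr : int -> K) A *m v = 0.
  apply/matrixP => i j; rewrite !mxE.
  transitivity (\sum_k ((i == k)%:R * w (enum_val k) -
      2%:R * ((M (enum_val i) (enum_val k))%:~R * w (enum_val k)))).
    apply: eq_bigr => k _; rewrite !mxE rmorphB rmorphM /= mulrBl; congr (_ - _).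
      by case: eqP.
    by rewrite -mulrA.
  rewrite sumrB -mulr_sumr (bigD1 i) //= eqxx mul1r big1 ?addr0 => [|k]; last first.
    by rewrite eq_sym => /negPf ->; rewrite mul0r.
  rewrite MP (reindex (@enum_val T predT)) /=; first exact: subrr.
  exact: onW_bij (enum_val_bij T).
have v0 : v = 0.
  apply/eqP; have := congr1 (mulmx (\adj (map_mx (intr : int -> K) A))) Av.
  rewrite mulmx0 mulmxA mul_adj_mx det_map_mx mul_scalar_mx => /eqP.
  by rewrite scaler_eq0 intr_eq0 (negPf detA).
(* For the constant function the product [w] is a power of [c a0]. *)
have := congr1 (fun u : 'cV_ _ => u (enum_rank ([ffun=> a0] : T)) 0) v0.
rewrite !mxE enum_rankK /w => /eqP; rewrite prodf_seq_eq0 => /hasP [i _].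
by rewrite ffunE => /eqP.
Qed.

End OddDeterminant.

(** * Polynomials modulo 2 *)

Section CoefficientGroups.
Variables (K : numFieldType) (n : nat) (Z : K -> Prop).
Hypotheses (Z0 : Z 0) (ZB : forall x y, Z x -> Z y -> Z (x - y)).
Implicit Types (p q : {mpoly K[n]}).

Definition coefs_in p := forall k, Z p@_k.

Lemma group_add x y : Z x -> Z y -> Z (x + y).
Proof. by move=> Zx Zy; have -> : x + y = x - (0 - y); [ring|apply: ZB => //; apply: ZB]. Qed.

Lemma group_muln x k : Z x -> Z (x *+ k).
Proof. by move=> Zx; elim: k => [|k IH]; rewrite ?mulr0n // mulrS; apply: group_add. Qed.

Lemma coefs_in0 : coefs_in 0.
Proof. by move=> k; rewrite mcoeff0. Qed.

Lemma coefs_inB p q : coefs_in p -> coefs_in q -> coefs_in (p - q).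
Proof. by move=> Zp Zq k; rewrite mcoeffB; apply: ZB. Qed.

Lemma coefs_inD p q : coefs_in p -> coefs_in q -> coefs_in (p + q).
Proof. by move=> Zp Zq k; rewrite mcoeffD; apply: group_add. Qed.

Lemma coefs_in_sum (I : Type) (r : seq I) (P : pred I) (F : I -> {mpoly K[n]}) :
  (forall i, P i -> coefs_in (F i)) -> coefs_in (\sum_(i <- r | P i) F i).
Proof. apply: big_ind; [exact: coefs_in0 | exact: coefs_inD]. Qed.

Lemma coefs_inXM i p : coefs_in p -> coefs_in ('X_i * p).
Proof.
move=> Zp k; rewrite mulrC; have [ik|ik] := boolP (U_(i) <= k)%MM.
  by rewrite -(submK ik) addmC mcoeffMX.
rewrite memN_msupp_eq0 //; apply: contra ik; rewrite (perm_mem (msuppMX _ _)).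
by case/mapP => m _ ->; apply: lem_addr.
Qed.

Lemma coefs_in_deriv i p : coefs_in p -> coefs_in (mderiv i p).
Proof. by move=> Zp k; rewrite mcoeff_deriv; apply: group_muln. Qed.

Lemma coefs_in_linM i (e : bool) p : coefs_in p -> coefs_in (('X_i + e%:R) * p).
Proof.
move=> Zp; rewrite mulrDl; apply: coefs_inD; first exact: coefs_inXM.
by case: e; rewrite ?mul1r // mul0r; apply: coefs_in0.
Qed.

Lemma coefs_in_linM_prod (T : {set 'I_n}) (eps : 'I_n -> bool) p :
  coefs_in p -> coefs_in ((\prod_(i in T) ('X_i + (eps i)%:R)) * p).
Proof.
move=> Zp; apply: (big_ind (fun q => forall p, coefs_in p -> coefs_in (q * p))) p Zp.
- by move=> p; rewrite mul1r.
- by move=> q q' IH IH' p /IH' /IH; rewrite mulrA.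
- by move=> i _ p; apply: coefs_in_linM.
Qed.

End CoefficientGroups.

(** * Extraction of squares modulo 2 by mixed derivatives *)

Section MixedDerivatives.
Variables (K : numFieldType) (n : nat) (Q : K -> Prop).
Hypotheses (Q0 : Q 0) (QB : forall x y, Q x -> Q y -> Q (x - y)).
Notation A := {mpoly K[n]}.
Implicit Types (p q f L : A) (T : {set 'I_n}) (eps : 'I_n -> bool).

Definition doubleQ x := exists2 y, Q y & x = 2%:R * y.

Lemma doubleQ0 : doubleQ 0.
Proof. by exists 0; rewrite ?mulr0. Qed.

Lemma doubleQB x y : doubleQ x -> doubleQ y -> doubleQ (x - y).
Proof. by move=> [a Qa ->] [b Qb ->]; exists (a - b); [apply: QB|rewrite mulrBr]. Qed.

Local Notation even := (coefs_in doubleQ).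
Local Notation evenB := (coefs_inB doubleQB).
Local Notation evenD := (coefs_inD doubleQ0 doubleQB).

Lemma even0 : even (0 : A).
Proof. apply: coefs_in0; exact: doubleQ0. Qed.

Lemma even_double p : coefs_in Q p -> even (p *+ 2).
Proof. by move=> Qp k; exists p@_k; rewrite ?mcoeffMn ?mulr_natl. Qed.

Definition cong p q := even (p - q).

Lemma cong_even p q : cong p q -> even q -> even p.
Proof. by move=> pq Eq; rewrite -(subrK q p); apply: evenD; first exact: pq. Qed.

Lemma cong_refl p : cong p p.
Proof. by rewrite /cong subrr; apply: even0. Qed.

Lemma cong_sym p q : cong p q -> cong q p.
Proof.
move=> pq; rewrite /cong -opprB -sub0r; apply: evenB; [exact: even0|exact: pq].
Qed.

Lemma cong_trans p q f : cong p q -> cong q f -> cong p f.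
Proof. by move=> pq qf; rewrite /cong -(subrK q p) -addrA; apply: evenD; [exact: pq|exact: qf]. Qed.

Lemma congD p q p' q' : cong p p' -> cong q q' -> cong (p + q) (p' + q').
Proof. by move=> pp qq; rewrite /cong opprD addrACA; apply: evenD; [exact: pp|exact: qq]. Qed.

(** This puts the coefficients of [L ^+ 2] and of [L * mderiv i L] into [Q], while those of [L]
    itself need not lie there. *)
Definition square_in L := forall a b, Q (L@_a * L@_b).

(* Modulo [2], a form is recovered from these operators: on
   [\prod_(i in T) ('X_i + eps i) * L ^+ 2] the operator with index [i] is the identity or
   zero (up to removing the factor of index [i]), according to whether
   [i \in T] is equivalent to [i \in T0]. *)
Definition op eps T0 i p := if i \in T0 then mderiv i p else p + ('X_i + (eps i)%:R) * mderiv i p.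
Definition ops eps T0 (s : seq 'I_n) p := foldl (fun f i => op eps T0 i f) p s.

Lemma opB eps T0 i p q : op eps T0 i (p - q) = op eps T0 i p - op eps T0 i q.
Proof. by rewrite /op; case: ifP => _; rewrite mderivB //; ring. Qed.

Lemma op_even eps T0 i p : even p -> even (op eps T0 i p).
Proof.
move=> Ep; have Ed := coefs_in_deriv doubleQ0 doubleQB i Ep.
rewrite /op; case: ifP => _ //; apply: evenD => //.
by apply: coefs_in_linM => //; [exact: doubleQ0 | exact: doubleQB].
Qed.

Lemma opsB eps T0 s p q : ops eps T0 s (p - q) = ops eps T0 s p - ops eps T0 s q.
Proof. by elim: s p q => //= i s IH p q; rewrite opB IH. Qed.

Lemma ops0 eps T0 s : ops eps T0 s 0 = 0.
Proof. by have := opsB eps T0 s 0 0; rewrite !subrr. Qed.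

Lemma opsD eps T0 s p q : ops eps T0 s (p + q) = ops eps T0 s p + ops eps T0 s q.
Proof. by have -> : p + q = p - (0 - q); [ring|rewrite !opsB ops0; ring]. Qed.

Lemma ops_even eps T0 s p : even p -> even (ops eps T0 s p).
Proof. by elim: s p => //= i s IH p Ep; apply/IH/op_even. Qed.

Lemma ops_cong eps T0 s p q : cong p q -> cong (ops eps T0 s p) (ops eps T0 s q).
Proof. by move=> pq; rewrite /cong -opsB; apply: ops_even; exact: pq. Qed.

Lemma eq_ops eps eps' T0 s p : {in s, eps =1 eps'} -> ops eps T0 s p = ops eps' T0 s p.
Proof.
elim: s p => //= i s IH p e; rewrite IH => [|j js]; last by rewrite e // inE js orbT.
by congr ops; rewrite /op e // mem_head.
Qed.

(* The difference of the operators for the two values of [eps i] is the derivative. *)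
Lemma even_of_ops s p : uniq s -> (forall eps, even (ops eps set0 s p)) -> even p.
Proof.
elim: s p => [|i s IH] p /=; first by move=> _ /(_ xpred0).
case/andP => is_ us h.
have op_i e : even (op (fun=> e) set0 i p).
  apply: IH => // eps; have := h (fun j => if j == i then e else eps j).
  rewrite (@eq_ops _ eps) => [|j js].
    by congr even; congr ops; rewrite /op inE eqxx.
  by case: eqP => // ji; rewrite -ji js in is_.
have := op_i true; have := op_i false; rewrite /op inE /= addr0 => E0 E1.
have Ed : even (mderiv i p) by have := evenB E1 E0; congr even; ring.
have := evenB E0 (coefs_inXM doubleQ0 i Ed); congr even; ring.
Qed.

Local Notation linprod eps T := (\prod_(i in T) ('X_i + (eps i)%:R : A)).

Lemma mderiv_linprod eps T i : i \notin T -> mderiv i (linprod eps T) = 0.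
Proof.
move=> iT; apply: (big_ind (fun p => mderiv i p = 0)).
- by rewrite -mpolyC1 mderivC.
- by move=> p q p0 q0; rewrite mderivM p0 q0 mul0r mulr0 addr0.
move=> j jT; rewrite mderivD -mpolyC_nat mderivC addr0 mderivX mnm1E.
by case: eqP => [ji|_]; [rewrite -ji jT in iT | rewrite scale0r].
Qed.

Lemma mderiv_lin eps i : mderiv i ('X_i + (eps i)%:R : A) = 1.
Proof.
rewrite mderivD -mpolyC_nat mderivC addr0 mderivX mnm1E eqxx scale1r.
by rewrite -[X in (X - _)%MM]addm0 addmC addmK mpolyX0.
Qed.

Lemma coefs_in_square L : square_in L -> coefs_in Q (L * L).
Proof.
move=> QL k; rewrite mcoeffM; apply: big_ind => // x y; exact: group_add.
Qed.

Lemma coefs_in_mulderiv L i : square_in L -> coefs_in Q (L * mderiv i L).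
Proof.
move=> QL k; rewrite mcoeffM; apply: big_ind => // [x y|a _]; first exact: group_add.
by rewrite mcoeff_deriv mulrnAr; apply: group_muln.
Qed.

Lemma even_linprod_double eps T p : coefs_in Q p -> even (linprod eps T * (p *+ 2)).
Proof.
move=> Qp; apply: coefs_in_linM_prod; [exact: doubleQ0|exact: doubleQB|exact: even_double].
Qed.

(** Modulo 2 the square [L ^+ 2] behaves like a constant, its derivative being [2 L L']. For
    [y = 'X_i + eps i] and [M] the rest of the term, [y M] has derivative [M], and
    [y M + y M = 2 y M] is even. *)
Lemma op_term eps T0 T i L : square_in L ->
  cong (op eps T0 i (linprod eps T * L ^+ 2))
    (if (i \in T) == (i \in T0) then linprod eps (T :\ i) * L ^+ 2 else 0).
Proof.
move=> QL; have dE : mderiv i (L ^+ 2) = (L * mderiv i L) *+ 2.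
  by rewrite expr2 mderivM; ring.
have Ed := even_linprod_double eps T (coefs_in_mulderiv i QL).
have Xd := coefs_in_linM doubleQ0 doubleQB i (eps i) Ed.
have [iT|iT] := boolP (i \in T); last first.
  have -> : T :\ i = T by apply/setP => j; rewrite !inE; case: eqP => // ->; rewrite (negPf iT).
  rewrite /op /cong mderivM mderiv_linprod // mul0r add0r dE.
  by case: ifP => _ /=; rewrite ?subr0 // [_ + _ * _]addrC addrK.
have Ed' := even_linprod_double eps (T :\ i) (coefs_in_mulderiv i QL).
have E2 := even_linprod_double eps T (coefs_in_square QL).
have TE : linprod eps T = ('X_i + (eps i)%:R) * linprod eps (T :\ i).
  by rewrite (big_setD1 i).
have dT : mderiv i (linprod eps T) = linprod eps (T :\ i).
  by rewrite TE mderivM mderiv_lin mul1r mderiv_linprod ?setD11 // mulr0 addr0.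
rewrite /op /cong mderivM dT dE; case: ifP => _ /=.
  by have := Ed; congr even; ring.
by have := evenD E2 Xd; congr even; rewrite TE; ring.
Qed.

Lemma ops_term eps T0 T s L : square_in L -> uniq s ->
  cong (ops eps T0 s (linprod eps T * L ^+ 2))
    (if all (fun i => (i \in T) == (i \in T0)) s
     then linprod eps (T :\: [set i in s]) * L ^+ 2 else 0).
Proof.
move=> QL; elim: s T => [|i s IH] T /=.
  by move=> _; rewrite (_ : [set i in [::]] = set0) ?setD0; [exact: cong_refl|apply/setP => j; rewrite !inE].
case/andP => is_ us; apply: cong_trans (ops_cong _ _ _ (op_term _ _ _ _ QL)) _.
case: ifP => _ /=; last by rewrite ops0; apply: cong_refl.
have := IH (T :\ i) us.
rewrite (_ : (T :\ i) :\: [set j in s] = T :\: [set j in i :: s]); last first.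
  by apply/setP => j; rewrite !inE; case: (j == i); case: (j \in s).
congr (cong _ (if _ then _ else _)); apply: eq_in_all => j js.
by rewrite !inE; have [ji|] := eqVneq j i; first by rewrite -ji js in is_.
Qed.

Lemma ops_sum eps T0 (L : {set 'I_n} -> A) : (forall T, square_in (L T)) ->
  cong (ops eps T0 (enum 'I_n) (\sum_(T : {set 'I_n}) linprod eps T * L T ^+ 2)) (L T0 ^+ 2).
Proof.
move=> QL; have -> : ops eps T0 (enum 'I_n) (\sum_(T : {set 'I_n}) linprod eps T * L T ^+ 2) =
    \sum_(T : {set 'I_n}) ops eps T0 (enum 'I_n) (linprod eps T * L T ^+ 2).
  by apply: (big_morph _ (opsD _ _ _) (ops0 _ _ _)).
have -> : L T0 ^+ 2 = \sum_(T : {set 'I_n}) (if T == T0 then L T ^+ 2 else 0).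
  by rewrite -big_mkcond big_pred1_eq.
apply: (big_ind2 cong); first exact: cong_refl.
  by move=> *; apply: congD.
move=> T _; have := ops_term eps T0 T (QL T) (enum_uniq 'I_n).
rewrite (_ : T :\: [set i in enum 'I_n] = set0) ?big_set0 ?mul1r; last first.
  by apply/setP => j; rewrite !inE mem_enum.
congr (cong _ (if _ then _ else _)); apply/allP/eqP => [h|-> //].
by apply/setP => j; apply/eqP/h; rewrite mem_enum.
Qed.

(** Modulo 2 the square of [L] is the sum of the [L@_m ^+ 2 *: 'X_[m + m]], and doubling is
    injective on exponents. *)
Lemma square_even_coef L k : square_in L -> even (L ^+ 2) -> doubleQ (L@_k ^+ 2).
Proof.
move=> QL EL; have [kL|kL] := boolP (k \in msupp L); last first.
  by rewrite memN_msupp_eq0 // expr0n; apply: doubleQ0.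
have sq (s : seq 'X_{1..n}) : exists q, coefs_in Q q /\
    (\sum_(m <- s) L@_m *: 'X_[m]) ^+ 2 = \sum_(m <- s) L@_m ^+ 2 *: 'X_[m + m] + q *+ 2 :> A.
  elim: s => [|m s [q [Qq IH]]].
    by exists 0; rewrite !big_nil mul0rn addr0 expr0n; split=> //; apply: coefs_in0.
  exists (\sum_(m' <- s) (L@_m * L@_m') *: 'X_[m + m'] + q); split.
    apply: coefs_inD => //; apply: coefs_in_sum => // m' _ a; rewrite mcoeffZ mcoeffX.
    by rewrite mulr_natr; apply: group_muln.
  rewrite !big_cons sqrrD IH -!mul_mpolyC; set S := \sum_(m' <- s) L@_m' *: _.
  have -> : \sum_(m' <- s) (L@_m * L@_m') *: 'X_[m + m'] = (L@_m)%:MP * 'X_[m] * S :> A.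
    rewrite mulr_sumr; apply: eq_bigr => m' _.
    by rewrite -!mul_mpolyC mpolyCM mpolyXD; ring.
  by rewrite mpolyXD expr2 mpolyCM; ring.
have [q [Qq LE]] := sq (msupp L); rewrite -mpolyE in LE.
have := EL (k + k)%MM; rewrite LE mcoeffD raddf_sum (bigD1_seq k) //= mcoeffZ mcoeffX eqxx mulr1.
rewrite big1 ?addr0 => [h|m mk]; last first.
  rewrite mcoeffZ mcoeffX; case: eqP => [/mnmP e|_]; last by rewrite mulr0.
  by case/eqP: mk; apply/mnmP => i; have := e i; rewrite !mnmDE; lia.
have := doubleQB h (even_double Qq (k + k)%MM); by rewrite addrK.
Qed.

End MixedDerivatives.

(** With [T0] empty the operators send [p] to [L S set0 ^+ 2 = 0] modulo 2, which makes [p] even.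
    With arbitrary [T0] they then show that every [L S T0 ^+ 2] is even, hence so are the squares of
    all coefficients, and [even_squares_eq0] applies. *)
Lemma no_common_pure_value (K : numFieldType) n (L : {set 'I_n} -> {set 'I_n} -> {mpoly K[n]})
    (p : {mpoly K[n]}) : (forall S : {set 'I_n}, L S set0 = 0) ->
  (forall S : {set 'I_n}, p =
    \sum_(T : {set 'I_n}) (\prod_(i in T) ('X_i + (i \in S)%:R)) * L S T ^+ 2) -> p = 0.
Proof.
move=> L0 pE; pose D := (\sum_S \sum_T msize (L S T))%N.
have LD S T : (msize (L S T) <= D)%N.
  by rewrite /D (bigD1 S) //= (bigD1 T) //= -addnA leq_addr.
pose c (a : {set 'I_n} * {set 'I_n} * 'X_{1..n < D}) : K := (L a.1.1 a.1.2)@_a.2.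
pose Q := quadspan c.
have Q0 : Q 0 by apply: quadspan0.
have QB x y : Q x -> Q y -> Q (x - y) by apply: quadspanB.
have QL S T : square_in Q (L S T).
  move=> a b.
  have cE m : (L S T)@_m = 0 \/ exists x, (L S T)@_m = c x.
    have [mD|mD] := ltnP (mdeg m) D; first by right; exists (S, T, BMultinom mD).
    by left; apply: memN_msupp_eq0; apply: msize_mdeg_ge; apply: leq_trans (LD S T) mD.
  case: (cE a) => [->|[x ->]]; first by rewrite mul0r.
  by case: (cE b) => [->|[y ->]]; rewrite ?mulr0 //; apply: quadspan_gen.
have Ep : coefs_in (doubleQ Q) p.
  apply: (even_of_ops Q0 QB (enum_uniq 'I_n)) => eps.
  (* Every pattern [eps] comes from a set [S]; this is where all [2 ^ n] expressions of [p]
     enter. *)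
  pose S := [set i | eps i]; rewrite (@eq_ops _ _ eps (fun i => i \in S)) => [|i _]; last by rewrite inE.
  rewrite (pE S); apply: (cong_even Q0 QB (ops_sum Q0 QB _ _ (QL S))).
  by rewrite L0 expr0n; apply: even0.
have EL S T : coefs_in (doubleQ Q) (L S T ^+ 2).
  have := ops_sum Q0 QB (fun i => i \in S) T (QL S); rewrite -(pE S) => h.
  by apply: (cong_even Q0 QB (cong_sym Q0 QB h)); apply: ops_even.
have c0 := @even_squares_eq0 _ _ c (fun a =>
  square_even_coef Q0 QB a.2 (QL a.1.1 a.1.2) (EL a.1.1 a.1.2)).
rewrite (pE set0) big1 // => T _; rewrite (_ : L _ _ = 0) ?expr0n ?mulr0 //.
apply/mpolyP => k; rewrite mcoeff0; have [kD|kD] := ltnP (mdeg k) D.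
  exact: (c0 (set0, T, BMultinom kD)).
by apply: memN_msupp_eq0; apply: msize_mdeg_ge; apply: leq_trans (LD _ _) kD.
Qed.

(** * Pure values of Pfister forms *)

Section PureValues.
Variable K : fieldType.
Implicit Types (s t l : seq K).

Lemma pf_head l : pf l = 1 :: behead (pf l).
Proof.
by elim: l => //= a l IH; rewrite /tens IH /= mulr1.
Qed.

Lemma perm_behead_pf l : perm_eq (behead (pf l)) (pure l [::]).
Proof.
rewrite -(perm_cons 1) -pf_head; elim: l => //= a l IH.
by apply: perm_trans (perm_pf_cons a l) _; rewrite cats0 -cat_cons perm_cat2r.
Qed.

(* The reflection taking the vector of value [1] to plus or minus the first basis vector. *)
Lemma isometric_orthogonal_value s t i j : (2%:R : K) != 0 -> isometric (1 :: s) t ->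
  (i < size t)%N -> (j < size t)%N -> i != j -> t`_i = 1 -> repr s t`_j.
Proof.
move=> two0 [st [P [_ PE]]] it jt ij ti; move: P PE => /= P PE; rewrite -st /= in it jt.
pose u k := P (Ordinal it) k; pose w k := P (Ordinal jt) k.
have PG (a b : 'I_(size s).+1) : \sum_(k < (size s).+1) (1 :: s)`_k * (P a k * P b k) = gram (size s).+1 t a b.
  rewrite -PE !mxE; apply: eq_bigr => k _; rewrite !mxE (bigD1 k) //= mxE eqxx big1 ?addr0.
    by rewrite /=; ring.
  by move=> k' /negPf k'k; rewrite mxE k'k mulr0.
have := PG (Ordinal it) (Ordinal it); have := PG (Ordinal it) (Ordinal jt).
have := PG (Ordinal jt) (Ordinal jt); rewrite !mxE !eqxx -val_eqE /= (negPf ij) ti.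
rewrite !big_ord_recl /= !mul1r -!/(u _) -!/(w _).
set ww := \sum_(k < _) _; set uw := \sum_(k < _) _; set uu := \sum_(k < _) _ => eww euw euu.
(* If [u ord0 = 1], the sign -1 gives [1 + 1], which is nonzero by assumption. *)
have [sg sg0 sgu] : exists2 e : K, e ^+ 2 = 1 & 1 - e * u ord0 != 0.
  have [u1|u1] := eqVneq (u ord0) 1; last first.
    by exists 1; rewrite ?expr1n // mul1r subr_eq0 eq_sym.
  by exists (-1); rewrite ?sqrrN ?expr1n // u1 mulr1 opprK.
(* The reflection along [sg * u - e_0] sends [w] to [w + lam * (sg * u - e_0)], whose coordinate at
   [e_0] is zero. *)
apply/reprP; pose lam := w ord0 / (1 - sg * u ord0).
exists (fun k => if insub k is Some k' then w (lift ord0 k') + lam * sg * u (lift ord0 k') else 0).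
transitivity (ww + 2%:R * lam * sg * uw + lam ^+ 2 * uu).
  rewrite -eww; have -> : uw = - (u ord0 * w ord0) by apply/eqP; rewrite -addr_eq0 addrC euw.
  have -> : uu = 1 - u ord0 * u ord0 by rewrite -euu addrC addKr.
  have -> : lam ^+ 2 * (1 - u ord0 * u ord0) = lam ^+ 2 * (1 - sg ^+ 2 * u ord0 ^+ 2).
    by rewrite sg0 mul1r expr2.
  by rewrite /lam; field.
have -> : lam ^+ 2 * uu = (lam * sg) ^+ 2 * uu by rewrite [in RHS]exprMn sg0 mulr1.
rewrite /ww /uw /uu !mulr_sumr -!big_split /=; apply: eq_bigr => k _.
by rewrite valK add0n /u /w; ring.
Qed.

(** The diagonal of the product begins with [1, - b, - a], so [- a] is the value of a vector
    orthogonal to one of value 1. *)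
Lemma common_slot a l b (c : seq K) : (2%:R : K) != 0 ->
  isometric (pf c) (tens (pf (a :: l)) (pf1 b)) -> repr (pure c [::]) (- a).
Proof.
move=> two0; rewrite [X in isometric X _]pf_head => iso.
have tE : exists r, tens (pf (a :: l)) (pf1 b) = [:: 1, - b, - a & r].
  rewrite /= (pf_head l) /tens /= !mulr1 !mul1r; by eexists.
case: tE iso => r -> iso.
apply/(chain_repr _ (chain_perm (perm_behead_pf c))).
exact: (@isometric_orthogonal_value _ _ 0%N 2%N two0 iso).
Qed.

Variable n : nat.
Implicit Types (y : 'I_n -> K) (T : {set 'I_n}).

(** Splitting the subsets by membership of [i] mirrors the decomposition of [pf (a :: l)] into
    [pf l] and [- a] times [pf l], with [y i = - a]. *)
Lemma sum_subsets_cons y (L1 L2 : {set 'I_n} -> K) i :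
  (forall T, i \in T -> L1 T = 0) ->
  \sum_(T : {set 'I_n}) (\prod_(j in T) y j) * (if i \in T then L2 (T :\ i) else L1 T) ^+ 2 =
  \sum_(T : {set 'I_n}) (\prod_(j in T) y j) * L1 T ^+ 2 +
  y i * \sum_(T : {set 'I_n} | i \notin T) (\prod_(j in T) y j) * L2 T ^+ 2.
Proof.
move=> L10; rewrite (bigID (fun T : {set 'I_n} => i \in T)) /= addrC; congr (_ + _).
  rewrite [RHS](bigID (fun T : {set 'I_n} => i \in T)) /= [X in _ = X + _]big1 ?add0r.
    by apply: eq_bigr => T /negPf ->.
  by move=> T /L10 ->; rewrite expr0n mulr0.
rewrite (reindex_onto (fun T => i |: T) (fun T => T :\ i)) /=; last exact: setD1K.
rewrite mulr_sumr; apply: eq_big => [T|T /andP [_ /eqP e]].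
  rewrite setU11 /=; apply/eqP/idP => [<-|iT]; first by rewrite setD11.
  exact: setU1K.
have iT : i \notin T by rewrite -e setD11.
by rewrite setU11 e big_setU1 //= mulrA.
Qed.

Lemma repr_pf_subsets y (s : seq 'I_n) v : uniq s -> repr (pf [seq - y i | i <- s]) v ->
  exists L : {set 'I_n} -> K, (forall T, ~~ (T \subset s) -> L T = 0) /\
    v = \sum_(T : {set 'I_n}) (\prod_(i in T) y i) * L T ^+ 2.
Proof.
elim: s v => [|i s IH] v /=.
  move=> _ [w /eqP]; rewrite mul1r subr_eq0 => /eqP ->.
  exists (fun T => if T == set0 then w else 0); split.
    by move=> T; case: eqP => // ->; case/subsetPn => i; rewrite inE.
  rewrite (bigD1 set0) //= big_set0 mul1r eqxx big1 ?addr0 // => T /negPf ->.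
  by rewrite expr0n mulr0.
case/andP => is_ us; rewrite -[tens _ _]/(pf (- y i :: [seq - y i | i <- s])).
rewrite (chain_repr _ (pf_cons _ _)) opprK => /repr_cat.
case=> _ [_ [/(IH _ us) [L1 [L10 ->]] /repr_sc [_ /(IH _ us) [L2 [L20 ->]] ->] ->]].
have nsub T : i \in T -> ~~ (T \subset s).
  by move=> iT; apply/subsetPn; exists i.
exists (fun T => if i \in T then L2 (T :\ i) else L1 T); split.
  move=> T; case: ifP => iT ns; [apply: L20|apply: L10]; apply: contra ns => /subsetP h.
    apply/subsetP => j jT; rewrite inE; case: eqP => //= /eqP ji.
    by apply: h; rewrite !inE ji.
  by apply/subsetP => j jT; rewrite inE h ?orbT.
rewrite sum_subsets_cons => [|T /nsub]; last exact: L10.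
congr (_ + _ * _); rewrite [LHS](bigID (fun T : {set 'I_n} => i \in T)) /= big1 ?add0r //.
by move=> T /nsub /L20 ->; rewrite expr0n mulr0.
Qed.

Lemma repr_pure_subsets y (s : seq 'I_n) v : uniq s -> repr (pure [seq - y i | i <- s] [::]) v ->
  exists L : {set 'I_n} -> K, [/\ L set0 = 0, forall T, ~~ (T \subset s) -> L T = 0 &
    v = \sum_(T : {set 'I_n}) (\prod_(i in T) y i) * L T ^+ 2].
Proof.
elim: s v => [|i s IH] v /=.
  move=> _ ->; exists (fun=> 0); split=> //.
  by rewrite big1 // => T _; rewrite expr0n mulr0.
case/andP => is_ us; rewrite opprK cats0 => /repr_cat.
case=> _ [_ [/(IH _ us) [L1 [L1e L10 ->]] /repr_sc [_ /(repr_pf_subsets us) [L2 [L20 ->]] ->] ->]].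
have nsub T : i \in T -> ~~ (T \subset s).
  by move=> iT; apply/subsetPn; exists i.
exists (fun T => if i \in T then L2 (T :\ i) else L1 T); split.
- by rewrite inE.
- move=> T; case: ifP => iT ns; [apply: L20|apply: L10]; apply: contra ns => /subsetP h.
    apply/subsetP => j jT; rewrite inE; case: eqP => //= /eqP ji.
    by apply: h; rewrite !inE ji.
  by apply/subsetP => j jT; rewrite inE h ?orbT.
rewrite sum_subsets_cons => [|T /nsub]; last exact: L10.
congr (_ + _ * _); rewrite [LHS](bigID (fun T : {set 'I_n} => i \in T)) /= big1 ?add0r //.
by move=> T /nsub /L20 ->; rewrite expr0n mulr0.
Qed.

End PureValues.

(** * Failure of linkage for [2 ^ n] forms, and the combined statement *)

Lemma not_linked (K : numFieldType) n : (2 <= n)%N ->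
  ~ m_linked {fraction {mpoly K[n]}} (2 ^ n) n.
Proof.
move=> n2 linked; pose F : fieldType := {fraction {mpoly K[n]}}.
have two0 : (2%:R : F) != 0.
  by rewrite -(rmorph_nat (@FracField.tofrac {mpoly K[n]})) tofrac_eq0 -mpolyC_nat mpolyC_eq0 pnatr_eq0.
pose x (S : {set 'I_n}) i : {mpoly K[n]} := 'X_i + (i \in S)%:R.
pose l S : seq F := [seq - (x S i)%:F | i <- enum 'I_n].
have x0 S i : x S i != 0.
  apply/eqP => /(congr1 (mcoeff U_(i)%MM)); rewrite mcoeffD -mpolyC_nat mcoeffC mnm1_eq0 mulr0.
  by rewrite mcoeffX eqxx addr0 mcoeff0 => /eqP; rewrite oner_eq0.
have [|pi [[c [cn [c0 ->]]] [b [b0 iso]]]] := linked (fun j => pf (l (nth set0 (enum {set 'I_n}) j))).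
  move=> j; exists (l (nth set0 (enum {set 'I_n}) j)); split; last split=> //.
    by rewrite size_map size_enum_ord.
  by rewrite all_map; apply/allP => i _; rewrite /= oppr_eq0 tofrac_eq0.
(* The common factor has [n - 1 >= 1] slots; [a] is the first one. *)
case: c cn c0 iso => [|a c] cn c0 iso; first by move: cn => /= cn; lia.
have rep (S : {set 'I_n}) : exists L : {set 'I_n} -> F, L set0 = 0 /\
    - a = \sum_(T : {set 'I_n}) (\prod_(i in T) (x S i)%:F) * L T ^+ 2.
  have Sj : (index S (enum {set 'I_n}) < 2 ^ n)%N.
    by rewrite -[n in (2 ^ n)%N]card_ord -cardsT -card_powerset powersetT cardsT cardE index_mem mem_enum.
  have := iso (Ordinal Sj); rewrite nth_index ?mem_enum //= => isoS.
  have [L [L0 _ LE]] := repr_pure_subsets (enum_uniq 'I_n) (common_slot two0 isoS).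
  by exists L.
have [L LP] := choice _ rep.
have [d [p [d0 pP]]] := common_denominator (fun ST => L ST.1 ST.2).
have a0 : a != 0 by case/andP: c0.
(* After clearing denominators [q S] equals [- a] times the square of [d], so it is the same
   polynomial for all [S]. *)
pose q (S : {set 'I_n}) := \sum_(T : {set 'I_n}) (\prod_(i in T) x S i) * p (S, T) ^+ 2.
have qE S : (q S)%:F = d%:F ^+ 2 * - a.
  have [_ ->] := LP S; rewrite rmorph_sum mulr_sumr; apply: eq_bigr => T _ /=.
  by rewrite tofracM tofracXn -(pP (S, T)) rmorph_prod /=; ring.
have : q set0 = 0.
  apply: (@no_common_pure_value K n (fun S T => p (S, T))) => S.
    by apply/eqP; rewrite -tofrac_eq0 -(pP (S, set0)) /=; have [-> _] := LP S; rewrite mulr0.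
  by apply/eqP; rewrite -tofrac_eq -[X in _ == X%:F]/(q S) !qE.
move/eqP; rewrite -tofrac_eq0 qE mulf_eq0 expf_eq0 tofrac_eq0 (negPf d0) /=.
by rewrite oppr_eq0 (negPf a0).
Qed.

Theorem theoremB (n : nat) : (2 <= n)%N ->
  m_linked (ratfun n) 3 n /\ ~ m_linked (ratfun n) (2 ^ n) n.
Proof.
move=> n2; split; last exact: not_linked.
apply: linked3 => //; last by move=> r N a; apply: tsen_lang uncountable_CC _ _ a.
by rewrite -(rmorph_nat (@FracField.tofrac {mpoly CC[n]})) tofrac_eq0 -mpolyC_nat mpolyC_eq0 pnatr_eq0.
Qed.
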